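(* For $|q|<1$, \begin{align*} \sum_{n=0}^\infty \frac{q^{n(n+1)/2}(-1;q)_n}{(q;q)_n} \sum_{i=0}^n q^{i^2} {n \brack i}_q &=\frac{(q^2;q^2)_\infty (q^3;q^3)_\infty^2}{(q;q)_\infty^2 (q^6;q^6)_\infty},\\ \sum_{n=0}^\infty \frac{q^{n(n+1)/2}(-q;q)_n}{(q;q)_n} \sum_{i=0}^n q^{i^2+i}{n \brack i}_q &=\frac{(q^6;q^6)_\infty^2}{(q;q)_\infty (q^3;q^3)_\infty},\\ \sum_{n=0}^\infty \frac{q^{n^2}(-q;q^2)_n}{(q^2;q^2)_n} \sum_{i=0}^n q^{2i^2} {n\brack i}_{q^2} &=\frac{(-q;q^2)_\infty (q^5,q^7,q^{12};q^{12})_\infty}{(q^2;q^2)_\infty},\\ \sum_{n=0}^\infty \frac{q^{n^2}(-q;q^2)_n}{(q^2;q^2)_n} \sum_{i=0}^n q^{2i^2+2i} {n\brack i}_{q^2} &=\frac{(-q;q^2)_\infty (q^3,q^9,q^{12};q^{12})_\infty}{(q^2;q^2)_\infty},\\ \sum_{n=0}^\infty \frac{q^{n^2+2n}(-q;q^2)_n}{(q^2;q^2)_n} \sum_{i=0}^n q^{2i^2+2i} {n\brack i}_{q^2} &=\frac{(-q;q^2)_\infty (q,q^{11},q^{12};q^{12})_\infty}{(q^2;q^2)_\infty}. \end{align*}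
   Context: For $|q|<1$: $(a;q)_0=1$, $(a;q)_n=\prod_{k=0}^{n-1}(1-aq^k)$, $(a;q)_\infty=\prod_{k\ge0}(1-aq^k)$, $(a_1,\dots,a_m;q)_n=\prod_{\ell}(a_\ell;q)_n$. The Gaussian coefficient ${n\brack m}_q=\frac{(q;q)_n}{(q;q)_m(q;q)_{n-m}}$ for $0\le m\le n$ and $0$ otherwise; ${n\brack m}_{q^2}$ is the same with $q$ replaced by $q^2$. *)

(* Defs.v *)
From Stdlib Require Import Reals.
From Coquelicot Require Import Coquelicot.
Open Scope C_scope.

Fixpoint Cpow (x : C) (n : nat) : C :=
  match n with O => 1 | S m => x * Cpow x m end.

Fixpoint qpoch (a q : C) (n : nat) : C :=
  match n with O => 1 | S m => qpoch a q m * (1 - a * Cpow q m) end.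

Definition qpoch_inf (a q : C) : C :=
  @lim C_CompleteNormedModule (filtermap (qpoch a q) eventually).

Definition qbinom (q : C) (n m : nat) : C :=
  if (m <=? n)%nat then qpoch q q n / (qpoch q q m * qpoch q q (n - m)) else 0.

Fixpoint Csum_to (f : nat -> C) (n : nat) : C :=
  match n with O => f O | S m => Csum_to f m + f (S m) end.

(* Main.v *)
Require Import Defs.
From Stdlib Require Import Reals Lra Lia.
From Coquelicot Require Import Coquelicot.
Open Scope C_scope.
Set Bullet Behavior "Strict Subproofs".

(** The outer weights dictate the parameter of the pair. With [rho] finite, Bailey's lemma produces
    the weight (-sigma)^n p^(n(n-1)/2), where rho sigma = p^(1+e). For p = q^2 and rho = -q, the
    weight q^(n^2) forces sigma = -q, hence e = 0, while q^(n^2+2n) forces sigma = -q^3, hence e =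
    1. The inner exponents i^2 and i^2+i independently ask for e = 0 and e = 1. In the fourth
    identity the two demands disagree, which is why the parameter must change between the two
    applications. In a truncated identity both sides carry 1/(p;p)_(N-n), so no infinite sums are
    ever interchanged; in the limit one factor 1/(p;p)_oo cancels and the other remains in the
    result. The theta series are kept one-sided, with z and y = s/z as separate arguments, so that
    no negative power of q occurs and q = 0 needs no separate treatment. *)

(* Up to a factor (q;q)_n, the inner sums are the beta-sequences obtained by applying
   Bailey's lemma with both parameters sent to infinity to the pair with beta_n = 1/(q;q)_n,
   relative to a = 1 or a = q.  A further application of Bailey's lemma, with one parameter
   finite (-1, -q) and the other one infinite, turns the outer sum into a theta series, which
   the Jacobi triple product evaluates.  Pairs relative to a = 1 come from pairs relative to
   a = q by keeping beta and replacing gamma_r (1 - q^(2r+1)) by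
   gamma_r - q^(2r-1) gamma_(r-1); the fourth identity does this between the inner and the
   outer application of Bailey's lemma.  Every step is a finite identity
   in an upper summation limit N, and N -> oo is taken by dominated convergence. *)

(** * Finite q-series *)

Lemma Csum_0 (f : nat -> C) : Csum_to f 0 = f O.
Proof. reflexivity. Qed.

Lemma Csum_S (f : nat -> C) n : Csum_to f (S n) = Csum_to f n + f (S n).
Proof. reflexivity. Qed.

Lemma Csum_ext (f g : nat -> C) n :
  (forall i, (i <= n)%nat -> f i = g i) -> Csum_to f n = Csum_to g n.
Proof.
  induction n as [|n IH]; intros H; simpl.
  - now apply H.
  - rewrite IH by (intros; apply H; lia). now rewrite H by lia.
Qed.

Lemma Csum_plus (f g : nat -> C) n :
  Csum_to (fun i => f i + g i) n = Csum_to f n + Csum_to g n.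
Proof. induction n as [|n IH]; simpl; [reflexivity|]. rewrite IH. ring. Qed.

Lemma Csum_scal (c : C) (f : nat -> C) n :
  Csum_to (fun i => c * f i) n = c * Csum_to f n.
Proof. induction n as [|n IH]; simpl; [reflexivity|]. rewrite IH. ring. Qed.

Lemma Csum_shift (f : nat -> C) n :
  Csum_to f (S n) = f O + Csum_to (fun i => f (S i)) n.
Proof.
  induction n as [|n IH]; [reflexivity|].
  rewrite Csum_S, IH. simpl. ring.
Qed.

Lemma Csum_triangle (f : nat -> nat -> C) N :
  Csum_to (fun n => Csum_to (fun r => f n r) n) N
  = Csum_to (fun r => Csum_to (fun m => f (r + m)%nat r) (N - r)) N.
Proof.
  induction N as [|N IH]; [reflexivity|].
  rewrite Csum_S, IH, (Csum_S _ N), (Csum_S _ N).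
  replace (S N - S N)%nat with O by lia. simpl (Csum_to _ 0).
  rewrite Nat.add_0_r, Cplus_assoc, <- Csum_plus. f_equal.
  apply Csum_ext; intros r Hr.
  replace (S N - r)%nat with (S (N - r)) by lia.
  rewrite Csum_S. now replace (r + S (N - r))%nat with (S N) by lia.
Qed.

Lemma Csum_fold (f : nat -> C) N :
  Csum_to f (S N + S N)
  = f (S N) + Csum_to (fun r => f (S N + S r)%nat + f (N - r)%nat) N.
Proof.
  (* [Csum_to] has no empty sum: the sum over [r] already starts at [f (S a)], so this central term
     is added and subtracted. *)
  assert (H : forall a k, Csum_to f (S a + k)
    = f (S a) + Csum_to f a + (Csum_to (fun r => f (a + S r)%nat) k - f (S a))).
  { intros a k; induction k as [|k IH].
    - rewrite Nat.add_0_r. simpl. rewrite Nat.add_1_r. ring.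
    - rewrite Nat.add_succ_r, Csum_S, IH. simpl.
      replace (S (a + k)) with (a + S k)%nat by lia.
      replace (S (a + S k)) with (a + S (S k))%nat by lia. ring. }
  rewrite H, Csum_shift.
  replace (N + 1)%nat with (S N) by lia.
  assert (R : Csum_to f N = Csum_to (fun r => f (N - r)%nat) N).
  { clear H; revert f; induction N as [|N IH]; intros f; [reflexivity|].
    rewrite Csum_S, Csum_shift, IH, Nat.sub_0_r.
    rewrite Cplus_comm. f_equal. }
  rewrite Csum_plus, <- R.
  rewrite (Csum_ext (fun i => f (N + S (S i))%nat) (fun r => f (S N + S r)%nat))
    by (intros; f_equal; lia).
  ring.
Qed.

(** The number n(n-1)/2, by recursion, so that exponents involve no division in [nat]. *)
Fixpoint tri (n : nat) : nat := match n with O => O | S m => tri m + m end.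

Lemma tri_double n : (2 * tri n + n = n * n)%nat.
Proof. induction n; simpl in *; lia. Qed.

Lemma tri_add m n : tri (m + n) = (tri m + tri n + m * n)%nat.
Proof.
  pose proof (tri_double m); pose proof (tri_double n);
  pose proof (tri_double (m + n)); nia.
Qed.

Lemma qpoch_S (a p : C) n : qpoch a p (S n) = qpoch a p n * (1 - a * p ^ n).
Proof. reflexivity. Qed.

Lemma qpoch_add (a p : C) m n :
  qpoch a p (m + n) = qpoch a p m * qpoch (a * p ^ m) p n.
Proof.
  induction n as [|n IH].
  - rewrite Nat.add_0_r. simpl. ring.
  - rewrite Nat.add_succ_r, !qpoch_S, IH, Cpow_add_r. ring.
Qed.

Lemma qpoch_Sl (a p : C) n : qpoch a p (S n) = (1 - a) * qpoch (a * p) p n.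
Proof.
  change (S n) with (1 + n)%nat. rewrite qpoch_add, Cpow_1_r.
  simpl. ring.
Qed.

Lemma one_minus_neq0 (x : C) : (Cmod x < 1)%R -> 1 - x <> 0.
Proof.
  intros H E. assert (x = 1) as -> by (rewrite <- (Cplus_0_r x), <- E; ring).
  rewrite Cmod_1 in H. lra.
Qed.

Lemma Cmod_pow_le1 (p : C) n : (Cmod p < 1)%R -> (Cmod (p ^ n) <= 1)%R.
Proof.
  intros H. rewrite Cmod_pow. rewrite <- (pow1 n).
  apply pow_incr. split; [apply Cmod_ge_0 | lra].
Qed.

Lemma Cmod_pow_lt1 (p : C) n : (Cmod p < 1)%R -> (Cmod (p ^ S n) < 1)%R.
Proof.
  intros H. rewrite Cpow_S, Cmod_mult.
  pose proof (Cmod_pow_le1 p n H). pose proof (Cmod_ge_0 p).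
  pose proof (Cmod_ge_0 (p ^ n)). nra.
Qed.

Lemma one_minus_pow_neq0 (p : C) n : (Cmod p < 1)%R -> 1 - p * p ^ n <> 0.
Proof. intros H. apply one_minus_neq0. now apply (Cmod_pow_lt1 p n). Qed.

Lemma qpoch_neq0 (p : C) n : (Cmod p < 1)%R -> qpoch p p n <> 0.
Proof.
  intros H. induction n as [|n IH].
  - apply C1_nz.
  - rewrite qpoch_S. apply Cmult_neq_0; [exact IH | now apply one_minus_pow_neq0].
Qed.

#[local] Hint Resolve qpoch_neq0 one_minus_pow_neq0 : qs.

Lemma qbinom_split (p : C) k m n : (m + n = k)%nat ->
  qbinom p k m = qpoch p p k / (qpoch p p m * qpoch p p n).
Proof.
  intros <-. unfold qbinom. destruct (Nat.leb_spec m (m + n)); [|lia].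
  now replace (m + n - m)%nat with n by lia.
Qed.

Lemma qbinom_eq (p : C) n m :
  qbinom p (m + n) m = qpoch p p (m + n) / (qpoch p p m * qpoch p p n).
Proof. now apply qbinom_split. Qed.

Lemma qbinom_gt (p : C) n m : (n < m)%nat -> qbinom p n m = 0.
Proof. intros H. unfold qbinom. destruct (Nat.leb_spec m n); [lia | reflexivity]. Qed.

Lemma qbinom_0 (p : C) n : (Cmod p < 1)%R -> qbinom p n 0 = 1.
Proof.
  intros H. change n with (0 + n)%nat at 1. rewrite qbinom_eq. simpl.
  field. auto with qs.
Qed.

Lemma qbinom_diag (p : C) n : (Cmod p < 1)%R -> qbinom p n n = 1.
Proof.
  intros H. rewrite <- (Nat.add_0_r n) at 1. rewrite qbinom_eq, Nat.add_0_r. simpl.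
  field. auto with qs.
Qed.

Lemma qbinom_pascal (p : C) n m : (Cmod p < 1)%R -> (m <= n)%nat ->
  qbinom p (S n) (S m) = qbinom p n (S m) + p ^ (n - m) * qbinom p n m.
Proof.
  intros H Hm. destruct (Nat.eq_dec m n) as [->|Hne].
  - rewrite !qbinom_diag, qbinom_gt, Nat.sub_diag by (auto; lia). simpl. ring.
  - assert (exists k, n = (m + S k)%nat) as [k ->] by (exists (n - S m)%nat; lia).
    replace (m + S k - m)%nat with (S k) by lia.
    rewrite (qbinom_eq p (S k) m).
    replace (S (m + S k)) with (S m + S k)%nat by lia. rewrite qbinom_eq.
    replace (m + S k)%nat with (S m + k)%nat by lia. rewrite qbinom_eq.
    rewrite Nat.add_succ_r, !qpoch_S. simpl (p ^ _). rewrite Cpow_add_r.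
    field. auto with qs.
Qed.

Lemma qbinom_pascal' (p : C) n m : (Cmod p < 1)%R -> (m <= n)%nat ->
  qbinom p (S n) (S m) = p ^ (S m) * qbinom p n (S m) + qbinom p n m.
Proof.
  intros H Hm. destruct (Nat.eq_dec m n) as [->|Hne].
  - rewrite !qbinom_diag, qbinom_gt by (auto; lia). simpl. ring.
  - assert (exists k, n = (m + S k)%nat) as [k ->] by (exists (n - S m)%nat; lia).
    rewrite (qbinom_eq p (S k) m).
    replace (S (m + S k)) with (S m + S k)%nat by lia. rewrite qbinom_eq.
    replace (m + S k)%nat with (S m + k)%nat by lia. rewrite qbinom_eq.
    rewrite Nat.add_succ_r, !qpoch_S. simpl (p ^ _). rewrite Cpow_add_r.
    field. auto with qs.
Qed.

(** Pascal's rule in summed form. In the inductions below, both sums on the right are again of the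
    original shape, up to a scalar and a shifted parameter. *)
Lemma qbinom_sum_S (p : C) (f : nat -> C) n : (Cmod p < 1)%R ->
  Csum_to (fun i => qbinom p (S n) i * f i) (S n)
  = Csum_to (fun i => qbinom p n i * f i) n
    + Csum_to (fun i => qbinom p n i * (p ^ (n - i) * f (S i))) n.
Proof.
  intros H.
  transitivity (Csum_to (fun i => qbinom p n i * f i) (S n)
    + Csum_to (fun i => qbinom p n i * (p ^ (n - i) * f (S i))) n).
  2:{ rewrite Csum_S, qbinom_gt by lia. ring. }
  rewrite !Csum_shift, !qbinom_0, <- Cplus_assoc, <- Csum_plus by easy. f_equal.
  apply Csum_ext; intros i Hi. rewrite qbinom_pascal by easy. ring.
Qed.

Lemma qbinom_sum_S' (p : C) (f : nat -> C) n : (Cmod p < 1)%R ->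
  Csum_to (fun i => qbinom p (S n) i * f i) (S n)
  = Csum_to (fun i => qbinom p n i * (p ^ i * f i)) n
    + Csum_to (fun i => qbinom p n i * f (S i)) n.
Proof.
  intros H.
  transitivity (Csum_to (fun i => qbinom p n i * (p ^ i * f i)) (S n)
    + Csum_to (fun i => qbinom p n i * f (S i)) n).
  2:{ rewrite Csum_S, qbinom_gt by lia. ring. }
  rewrite !Csum_shift, !qbinom_0, <- Cplus_assoc, <- Csum_plus by easy.
  f_equal; [simpl; ring|].
  apply Csum_ext; intros i Hi. rewrite qbinom_pascal' by easy. ring.
Qed.

(** Pascal's rule splits the sum for [S M] into (1 - A B p^M) times the sum for [A] and -(1 - A) B
    p^M times the sum for [A * p]. By induction both sums equal (B;p)_M, and the two scalars add up
    to 1 - B p^M. The shift to [A * p] is why [A] is generalised. *)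
Lemma q_chu_vandermonde (p A B : C) M : (Cmod p < 1)%R ->
  Csum_to (fun m => qbinom p M m * (qpoch A p m * (- B) ^ m * p ^ tri m
    * qpoch (A * B * p ^ m) p (M - m))) M = qpoch B p M.
Proof.
  intros H. revert A. induction M as [|M IH]; intros A.
  - simpl. rewrite qbinom_0 by easy. ring.
  - rewrite qbinom_sum_S by easy.
    rewrite (Csum_ext _ (fun m => (1 - A * B * p ^ M) * (qbinom p M m *
      (qpoch A p m * (- B) ^ m * p ^ tri m * qpoch (A * B * p ^ m) p (M - m))))).
    2:{ intros m Hm. replace (S M - m)%nat with (S (M - m)) by lia.
        rewrite qpoch_S.
        replace (p ^ M) with (p ^ m * p ^ (M - m)) by (rewrite <- Cpow_add_r; f_equal; lia).
        ring. }
    rewrite Csum_scal, IH.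
    rewrite (Csum_ext _ (fun m => ((1 - A) * (- B) * p ^ M) * (qbinom p M m *
      (qpoch (A * p) p m * (- B) ^ m * p ^ tri m * qpoch (A * p * B * p ^ m) p (M - m))))).
    2:{ intros m Hm. rewrite Nat.sub_succ, qpoch_Sl.
        replace (p ^ M) with (p ^ (M - m) * p ^ m) by (rewrite <- Cpow_add_r; f_equal; lia).
        simpl tri. rewrite Cpow_add_r, !Cpow_S.
        replace (A * B * (p * p ^ m)) with (A * p * B * p ^ m) by ring. ring. }
    rewrite Csum_scal, IH, qpoch_S. ring.
Qed.

(* The limit [A -> oo] of [q_chu_vandermonde] with [c = A B] fixed. *)
Lemma q_chu_vandermonde_lim (p c : C) M : (Cmod p < 1)%R ->
  Csum_to (fun m => qbinom p M m * (c ^ m * p ^ (2 * tri m)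
    * qpoch (c * p ^ m) p (M - m))) M = 1.
Proof.
  intros H. revert c. induction M as [|M IH]; intros c.
  - simpl. rewrite qbinom_0 by easy. ring.
  - rewrite qbinom_sum_S by easy.
    rewrite (Csum_ext _ (fun m => (1 - c * p ^ M) * (qbinom p M m *
      (c ^ m * p ^ (2 * tri m) * qpoch (c * p ^ m) p (M - m))))).
    2:{ intros m Hm. replace (S M - m)%nat with (S (M - m)) by lia.
        rewrite qpoch_S.
        replace (p ^ M) with (p ^ m * p ^ (M - m)) by (rewrite <- Cpow_add_r; f_equal; lia).
        ring. }
    rewrite Csum_scal, IH.
    rewrite (Csum_ext _ (fun m => (c * p ^ M) * (qbinom p M m *
      ((c * p) ^ m * p ^ (2 * tri m) * qpoch (c * p * p ^ m) p (M - m))))).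
    2:{ intros m Hm. rewrite Nat.sub_succ.
        replace (p ^ M) with (p ^ (M - m) * p ^ m) by (rewrite <- Cpow_add_r; f_equal; lia).
        simpl tri. replace (2 * (tri m + m))%nat with (2 * tri m + m + m)%nat by lia.
        rewrite !Cpow_add_r, Cpow_mult_l, !Cpow_S.
        replace (c * (p * p ^ m)) with (c * p * p ^ m) by ring. ring. }
    rewrite Csum_scal, IH. ring.
Qed.

(** * Bailey's lemma in finite form *)

(* A Bailey pair relative to a = p^e; alpha absorbs the constant factor between
   (a p; p)_(n+r) and (p; p)_(n+r+e). *)
Definition bailey_pair (p : C) (e : nat) (alpha beta : nat -> C) : Prop :=
  forall n, beta n = Csum_to (fun r => alpha r
    / (qpoch p p (n - r) * qpoch p p (n + r + e))) n.

(** Bailey's lemma as an interchange of two finite sums: once [beta] is expanded and n = r + m, the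
    sum over [m] involves neither [alpha] nor [beta]. Its evaluation [v] is left as a hypothesis, so
    that the two choices of weight [w] below share the interchange. *)
Lemma bailey_transform (p : C) (e : nat) (alpha beta w : nat -> C)
    (v : nat -> nat -> C) N :
  (Cmod p < 1)%R -> bailey_pair p e alpha beta ->
  (forall r M, Csum_to (fun m => w (r + m)%nat
      / (qpoch p p m * qpoch p p (M - m) * qpoch p p (2 * r + e + m))) M
    = v r M / (qpoch p p M * qpoch p p (2 * r + e + M))) ->
  Csum_to (fun n => w n * beta n / qpoch p p (N - n)) N
  = Csum_to (fun r => alpha r * v r (N - r)%nat
      / (qpoch p p (N - r) * qpoch p p (N + r + e))) N.
Proof.
  intros H Hb K.
  rewrite (Csum_ext _ (fun n => Csum_to (fun r => w n / qpoch p p (N - n) *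
    (alpha r / (qpoch p p (n - r) * qpoch p p (n + r + e)))) n)).
  2:{ intros n Hn. rewrite Csum_scal, (Hb n). unfold Cdiv. ring. }
  rewrite Csum_triangle. apply Csum_ext; intros r Hr.
  rewrite (Csum_ext _ (fun m => alpha r * (w (r + m)%nat
      / (qpoch p p m * qpoch p p (N - r - m) * qpoch p p (2 * r + e + m))))).
  2:{ intros m Hm. replace (N - (r + m))%nat with (N - r - m)%nat by lia.
      replace (r + m - r)%nat with m by lia.
      replace (r + m + r + e)%nat with (2 * r + e + m)%nat by lia.
      field. auto 10 with qs. }
  rewrite Csum_scal, K. replace (2 * r + e + (N - r))%nat with (N + r + e)%nat by lia.
  unfold Cdiv. ring.
Qed.

(** Since (p;p)_(c+M) = (p;p)_(c+m) (p^(c+1+m);p)_(M-m), clearing denominators turns the kernel into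
    a q-binomial sum of Chu-Vandermonde type in which A B = p^(c+1). *)
Lemma bailey_kernel (p S : C) (f : nat -> C) (c M : nat) : (Cmod p < 1)%R ->
  Csum_to (fun m => qbinom p M m * (f m * qpoch (p ^ (c + 1) * p ^ m) p (M - m))) M = S ->
  Csum_to (fun m => f m / (qpoch p p m * qpoch p p (M - m) * qpoch p p (c + m))) M
  = S / (qpoch p p M * qpoch p p (c + M)).
Proof.
  intros H <-. unfold Cdiv. rewrite Cmult_comm, <- Csum_scal.
  apply Csum_ext; intros m Hm.
  assert (exists k, M = (m + k)%nat) as [k ->] by (exists (M - m)%nat; lia).
  rewrite qbinom_eq. replace (m + k - m)%nat with k by lia.
  replace (c + (m + k))%nat with ((c + m) + k)%nat by lia.
  rewrite (qpoch_add p p (c + m)).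
  replace (p * p ^ (c + m)) with (p ^ (c + 1) * p ^ m)
    by (rewrite !Cpow_add_r; simpl; ring).
  assert (E : qpoch p p (c + m) * qpoch (p ^ (c + 1) * p ^ m) p k <> 0).
  { replace (p ^ (c + 1) * p ^ m) with (p * p ^ (c + m))
      by (rewrite !Cpow_add_r; simpl; ring).
    rewrite <- qpoch_add. auto with qs. }
  field. repeat split; auto with qs.
  intros E'. apply E. rewrite E'. ring.
Qed.

Lemma bailey_step (p : C) (e : nat) (alpha beta : nat -> C) :
  (Cmod p < 1)%R -> bailey_pair p e alpha beta ->
  bailey_pair p e (fun r => p ^ (r * r + e * r) * alpha r)
    (fun n => Csum_to (fun i => p ^ (i * i + e * i) * beta i / qpoch p p (n - i)) n).
Proof.
  intros H Hb N.
  rewrite (bailey_transform p e alpha beta (fun n => p ^ (n * n + e * n))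
    (fun r _ => p ^ (r * r + e * r)) N H Hb).
  - apply Csum_ext; intros. unfold Cdiv. ring.
  (* With c = 2r + e, the exponent splits as (r+m)^2 + e(r+m) = (r^2 + e r) + (c+1) m + m(m-1). The
     part in [m] is the summand of the limiting Chu-Vandermonde sum, which equals 1; the kernel
     value therefore does not depend on [M]. *)
  - intros r M. apply bailey_kernel; [easy|].
    rewrite (Csum_ext _ (fun m => p ^ (r * r + e * r) * (qbinom p M m *
      ((p ^ (2 * r + e + 1)) ^ m * p ^ (2 * tri m)
       * qpoch (p ^ (2 * r + e + 1) * p ^ m) p (M - m))))).
    + rewrite Csum_scal, q_chu_vandermonde_lim by easy. ring.
    + intros m Hm.
      replace ((r + m) * (r + m) + e * (r + m))%nat
        with ((r * r + e * r) + ((2 * r + e + 1) * m + 2 * tri m))%nat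
        by (pose proof (tri_double m); nia).
      rewrite (Cpow_add_r p (r * r + e * r)), (Cpow_add_r p ((2 * r + e + 1) * m)),
        Cpow_mult_r. ring.
Qed.

Lemma bailey_rho_step (p rho sigma : C) (e : nat) (alpha beta : nat -> C) N :
  (Cmod p < 1)%R -> rho * sigma = p ^ (1 + e) -> bailey_pair p e alpha beta ->
  Csum_to (fun n => qpoch rho p n * (- sigma) ^ n * p ^ tri n * beta n
      / qpoch p p (N - n)) N
  = Csum_to (fun r => alpha r * (qpoch rho p r * (- sigma) ^ r * p ^ tri r
      * qpoch (sigma * p ^ r) p (N - r))
      / (qpoch p p (N - r) * qpoch p p (N + r + e))) N.
Proof.
  intros H Hrs Hb.
  apply (bailey_transform p e alpha beta
    (fun n => qpoch rho p n * (- sigma) ^ n * p ^ tri n)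
    (fun r M => qpoch rho p r * (- sigma) ^ r * p ^ tri r
      * qpoch (sigma * p ^ r) p M) N H Hb).
  intros r M. apply bailey_kernel; [easy|].
  (* The condition on [rho * sigma] is exactly what makes A = rho p^r and B = sigma p^r satisfy A B
     = p^(2r+e+1), as the kernel requires. *)
  rewrite <- (q_chu_vandermonde p (rho * p ^ r) (sigma * p ^ r)) by easy.
  rewrite <- Csum_scal. apply Csum_ext; intros m Hm.
  rewrite qpoch_add, tri_add, !Cpow_add_r, Cpow_mult_r.
  replace (- (sigma * p ^ r)) with (- sigma * p ^ r) by ring.
  rewrite Cpow_mult_l.
  replace (rho * p ^ r * (sigma * p ^ r)) with (p ^ (2 * r) * p ^ e * p ^ 1).
  2:{ replace (rho * p ^ r * (sigma * p ^ r)) with (rho * sigma * (p ^ r * p ^ r)) by ring.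
      rewrite Hrs, <- !Cpow_add_r. f_equal. lia. }
  ring.
Qed.

Lemma unit_bailey_pair (p : C) : (Cmod p < 1)%R ->
  bailey_pair p 1 (fun r => (- (1)) ^ r * p ^ tri r * (1 - p ^ (2 * r + 1)))
    (fun n => match n with O => 1 | _ => 0 end).
Proof.
  intros H n.
  (* With n = j + d + 1, every partial sum stopping before the top index has a product form.
     Formally its value at j = n would contain 1/(p;p)_(-1) = 0, the reason why the full sum
     vanishes; in the code the top term is added separately to the case d = 0. *)
  assert (T : forall j d, Csum_to (fun r => (- (1)) ^ r * p ^ tri r * (1 - p ^ (2 * r + 1))
      / (qpoch p p (j + S d - r) * qpoch p p (j + S d + r + 1))) j
    = (- (1)) ^ j * p ^ tri (S j) * (1 - p ^ S j)
      / (qpoch p p d * qpoch p p (j + S d + j + 1) * (1 - p ^ (j + S d)))).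
  { induction j as [|j IH]; intros d.
    - rewrite !Csum_0. replace (0 + S d - 0)%nat with (S d) by lia.
      replace (0 + S d + 0 + 1)%nat with (S (S d)) by lia.
      replace (0 + S d)%nat with (S d) by lia.
      replace (2 * 0 + 1)%nat with 1%nat by lia.
      rewrite !qpoch_S. pose proof (one_minus_pow_neq0 p (S d) H) as N.
      pose proof (one_minus_pow_neq0 p d H) as N'.
      simpl in *. field. auto with qs.
    - rewrite Csum_S.
      replace (S j + S d)%nat with (j + S (S d))%nat by lia. rewrite IH.
      replace (j + S (S d) - S j)%nat with (S d) by lia.
      replace (j + S (S d) + S j + 1)%nat with (S (j + S (S d) + j + 1)) by lia.
      rewrite !qpoch_S.
      replace (j + S (S d))%nat with (S (j + S d)) by lia.
      simpl tri. replace (2 * S j + 1)%nat with (j + j + 3)%nat by lia.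
      replace (S (j + S d) + j + 1)%nat with (j + j + d + 3)%nat by lia.
      replace (S (j + S d)) with (j + d + 2)%nat by lia.
      assert (N1 : 1 - p * p ^ (j + j + d + 3) <> 0) by auto with qs.
      assert (N2 : 1 - p ^ (j + d + 2) <> 0)
        by (replace (j + d + 2)%nat with (S (j + d + 1)) by lia; apply (one_minus_pow_neq0 p _ H)).
      assert (N3 : qpoch p p (j + j + d + 3) <> 0) by auto with qs.
      revert N1 N2 N3. generalize (qpoch p p (j + j + d + 3)). intros P3 N1 N2 N3.
      assert (N4 : 1 - p * p ^ d <> 0) by auto with qs.
      assert (N5 : qpoch p p d <> 0) by auto with qs.
      rewrite ?Cpow_add_r, ?Cpow_S in *. simpl in *. rewrite ?Cmult_1_r in *.
      field. repeat split; assumption. }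
  destruct n as [|n].
  - simpl. pose proof (one_minus_pow_neq0 p 0 H) as N. simpl in N. rewrite Cmult_1_r in N. field. exact N.
  - rewrite Csum_S, <- (Nat.add_1_r n), T.
    replace (n + 1 - (n + 1))%nat with O by lia.
    replace (n + 1 + (n + 1) + 1)%nat with (S (n + 1 + n + 1)) by lia.
    rewrite !qpoch_S.
    replace (2 * (n + 1) + 1)%nat with (S (n + 1 + n + 1)) by lia.
    rewrite (Nat.add_1_r n).
    assert (N1 : 1 - p * p ^ (S n + n + 1) <> 0) by auto with qs.
    assert (N2 : 1 - p * p ^ n <> 0) by auto with qs.
    assert (N3 : qpoch p p (S n + n + 1) <> 0) by auto with qs.
    rewrite !Cpow_S. simpl (qpoch p p 0).
    field. auto.
Qed.

(** The reason is the splitting 1 - p^(2r+1) = (1 - p^(n+r+1)) - p^(2r+1) (1 - p^(n-r)). Divided by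
    (p;p)_(n-r) (p;p)_(n+r+1), the first part gives the kernel for e = 0 at index [r], the second
    the one at index r + 1; collecting equal indices yields the new [alpha]. *)
Lemma bailey_pair_lower (p : C) (gamma beta : nat -> C) : (Cmod p < 1)%R ->
  bailey_pair p 1 (fun r => gamma r * (1 - p ^ (2 * r + 1))) beta ->
  bailey_pair p 0 (fun r => match r with O => gamma O
    | S s => gamma (S s) - p ^ (2 * s + 1) * gamma s end) beta.
Proof.
  intros H Hb.
  set (al := fun r => match r with O => gamma O
    | S s => gamma (S s) - p ^ (2 * s + 1) * gamma s end).
  intros n. rewrite (Hb n).
  (* The correction term is the part of the summand [j] that belongs to index j + 1 and has not yet
     been collected. It is absent at j = n, since 1 - p^(n-r) vanishes for r = n. *)
  assert (T : forall j d, Csum_to (fun r => gamma r * (1 - p ^ (2 * r + 1))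
      / (qpoch p p (j + S d - r) * qpoch p p (j + S d + r + 1))) j
    = Csum_to (fun r => al r / (qpoch p p (j + S d - r) * qpoch p p (j + S d + r + 0))) j
      - p ^ (2 * j + 1) * gamma j / (qpoch p p d * qpoch p p (j + S d + j + 1))).
  { induction j as [|j IH]; intros d.
    - rewrite !Csum_0. replace (0 + S d - 0)%nat with (S d) by lia.
      replace (0 + S d + 0 + 1)%nat with (S (S d)) by lia.
      replace (0 + S d + 0 + 0)%nat with (S d) by lia.
      rewrite !qpoch_S. simpl.
      pose proof (one_minus_pow_neq0 p (S d) H). field. auto with qs.
    - rewrite !Csum_S.
      replace (S j + S d)%nat with (j + S (S d))%nat by lia. rewrite IH.
      replace (j + S (S d) - S j)%nat with (S d) by lia.
      replace (j + S (S d) + S j + 1)%nat with (S (j + S (S d) + j + 1)) by lia.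
      replace (j + S (S d) + S j + 0)%nat with (j + S (S d) + j + 1)%nat by lia.
      rewrite !qpoch_S. simpl al.
      replace (2 * S j + 1)%nat with (2 * j + 1 + 2)%nat by lia.
      replace (j + S (S d) + j + 1)%nat with (2 * j + 1 + d + 2)%nat by lia.
      assert (N1 : 1 - p * p ^ (2 * j + 1 + d + 2) <> 0) by auto with qs.
      assert (N3 : qpoch p p (2 * j + 1 + d + 2) <> 0) by auto with qs.
      revert N1 N3. generalize (qpoch p p (2 * j + 1 + d + 2)). intros P3 N1 N3.
      assert (N4 : 1 - p * p ^ d <> 0) by auto with qs.
      assert (N5 : qpoch p p d <> 0) by auto with qs.
      change (j + (j + 0) + 1)%nat with (2 * j + 1)%nat.
      rewrite (Cpow_add_r p (2 * j + 1 + d) 2), (Cpow_add_r p (2 * j + 1) d),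
        (Cpow_add_r p (2 * j + 1) 2).
      rewrite (Cpow_add_r p (2 * j + 1 + d) 2), (Cpow_add_r p (2 * j + 1) d) in N1.
      generalize dependent (p ^ (2 * j + 1)). intros X _ N1.
      simpl (p ^ 2) in *. rewrite ?Cmult_1_r in *.
      field. auto. }
  destruct n as [|n].
  - simpl. pose proof (one_minus_pow_neq0 p 0 H) as N. simpl in N. rewrite Cmult_1_r in N. field. exact N.
  - rewrite !Csum_S, <- (Nat.add_1_r n), T.
    replace (n + 1 - (n + 1))%nat with O by lia.
    replace (n + 1 + (n + 1) + 1)%nat with (S (n + 1 + n + 1)) by lia.
    replace (n + 1 + (n + 1) + 0)%nat with (n + 1 + n + 1)%nat by lia.
    rewrite !qpoch_S.
    replace (2 * (n + 1) + 1)%nat with (S (n + 1 + n + 1)) by lia.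
    replace (2 * n + 1)%nat with (n + n + 1)%nat by lia.
    rewrite (Nat.add_1_r n). simpl al.
    replace (2 * n + 1)%nat with (n + n + 1)%nat by lia.
    assert (N1 : 1 - p * p ^ (S n + n + 1) <> 0) by auto with qs.
    assert (N3 : qpoch p p (S n + n + 1) <> 0) by auto with qs.
    rewrite !Cpow_S. simpl (qpoch p p 0).
    change (n + (n + 0) + 1)%nat with (2 * n + 1)%nat.
    replace (2 * n + 1)%nat with (n + n + 1)%nat by lia.
    field. auto.
Qed.

(** * The Jacobi triple product *)

(** The nonnegative half of the bilateral theta series with terms (-z)^n s^(n(n-1)/2). The term of
    index -n is [theta_term y s n] with y = s/z, so the condition [z * y = s] replaces division by
    [z]. *)
Definition theta_term (z s : C) (n : nat) : C := (- z) ^ n * s ^ tri n.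

Lemma theta_term_0 (z s : C) : theta_term z s 0 = 1.
Proof. unfold theta_term. simpl. ring. Qed.

Lemma theta_term_S (z s : C) n : theta_term z s (S n) = - z * s ^ n * theta_term z s n.
Proof. unfold theta_term. simpl tri. rewrite Cpow_S, Cpow_add_r. ring. Qed.

(* One of the two truncated differences is 0, so the summand is the theta term of
   index [i - N], in [z] for [N <= i] and in [y] for [i <= N]. *)
Lemma jacobi_triple_product_fin (z y s : C) M N : (Cmod s < 1)%R -> z * y = s ->
  Csum_to (fun i => qbinom s (M + N) i
    * (theta_term z s (i - N) * theta_term y s (N - i))) (M + N)
  = qpoch z s M * qpoch y s N.
Proof.
  (* [N] grows only at M = 0, by one form of Pascal's rule, and then [M] grows by the other; each
     step contributes one factor 1 - y s^N or 1 - z s^M. *)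
  intros H Hzy. induction M as [|M IH]; [induction N as [|N IHN]|].
  - simpl. rewrite qbinom_0, !theta_term_0 by easy. ring.
  - simpl (0 + _)%nat in *. rewrite qbinom_sum_S' by easy.
    rewrite (Csum_ext _ (fun i => (- y * s ^ N) * (qbinom s N i
      * (theta_term z s (i - N) * theta_term y s (N - i))))).
    2:{ intros i Hi. replace (i - S N)%nat with (i - N)%nat by lia.
        replace (S N - i)%nat with (S (N - i)) by lia. rewrite theta_term_S.
        replace (s ^ N) with (s ^ i * s ^ (N - i)) by (rewrite <- Cpow_add_r; f_equal; lia).
        ring. }
    rewrite Csum_scal. simpl (S _ - S _)%nat. rewrite IHN, qpoch_S. ring.
  - simpl (S M + N)%nat. rewrite qbinom_sum_S, IH by easy.
    rewrite (Csum_ext _ (fun i => (- z * s ^ M) * (qbinom s (M + N) i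
      * (theta_term z s (i - N) * theta_term y s (N - i))))).
    + rewrite Csum_scal, IH, qpoch_S. ring.
    + intros i Hi. destruct (Nat.le_gt_cases N i) as [Hle|Hlt].
      * replace (S i - N)%nat with (S (i - N)) by lia.
        replace (N - S i)%nat with O by lia. replace (N - i)%nat with O by lia.
        rewrite theta_term_S.
        replace (s ^ M) with (s ^ (M + N - i) * s ^ (i - N))
          by (rewrite <- Cpow_add_r; f_equal; lia).
        ring.
      (* Left of the centre, raising [i] removes a factor containing [y] instead of adding one
         containing [z]; [z * y = s] converts one into the other. *)
      * replace (N - i)%nat with (S (N - S i)) by lia.
        replace (S i - N)%nat with O by lia. replace (i - N)%nat with O by lia.
        rewrite theta_term_S.
        replace (M + N - i)%nat with (1 + (M + (N - S i)))%nat by lia.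
        rewrite (Cpow_add_r s 1), (Cpow_add_r s M), Cpow_1_r.
        replace (s * (s ^ M * s ^ (N - S i))) with (z * y * (s ^ M * s ^ (N - S i)))
          by now rewrite Hzy.
        ring.
Qed.

(** * Complex limits, dominated convergence and infinite products *)

(** Stated through moduli, so that the library of real limits and squeeze arguments applies
    directly. *)
Definition Clim (u : nat -> C) (l : C) : Prop :=
  is_lim_seq (fun n => Cmod (u n - l)) 0%R.

Lemma Clim_le (u : nat -> C) l (v : nat -> R) :
  (forall n, (Cmod (u n - l) <= v n)%R) -> is_lim_seq v 0%R -> Clim u l.
Proof.
  intros H Hv. apply (is_lim_seq_le_le (fun _ => 0%R) _ v); [|apply is_lim_seq_const|exact Hv].
  intros n. split; [apply Cmod_ge_0 | apply H].
Qed.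

Lemma Clim_filterlim (u : nat -> C) (l : C) :
  Clim u l <-> filterlim u eventually (@locally C_NormedModule l).
Proof.
  rewrite (filterlim_locally_ball_norm (K := C_AbsRing) (U := C_NormedModule)).
  unfold Clim. split.
  - intros H eps. apply is_lim_seq_spec in H. destruct (H eps) as [N HN].
    exists N. intros n Hn. specialize (HN n Hn).
    rewrite Rminus_0_r, Rabs_pos_eq in HN by apply Cmod_ge_0. exact HN.
  - intros H. apply is_lim_seq_spec. intros eps. destruct (H eps) as [N HN].
    exists N. intros n Hn. specialize (HN n Hn).
    rewrite Rminus_0_r, Rabs_pos_eq by apply Cmod_ge_0. exact HN.
Qed.

Lemma Clim_unique (u : nat -> C) l l' : Clim u l -> Clim u l' -> l = l'.
Proof.
  rewrite !Clim_filterlim.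
  apply (filterlim_locally_unique (V := C_NormedModule) u).
Qed.

Lemma Clim_ext (u v : nat -> C) l : (forall n, u n = v n) -> Clim u l -> Clim v l.
Proof. intros H. apply is_lim_seq_ext. intros n. now rewrite H. Qed.

Lemma Clim_const (c : C) : Clim (fun _ => c) c.
Proof.
  apply (is_lim_seq_ext (fun _ => 0%R)); [|apply is_lim_seq_const].
  intros _. replace (c - c) with (RtoC 0) by ring. now rewrite Cmod_0.
Qed.

Lemma Clim_plus (u v : nat -> C) l m :
  Clim u l -> Clim v m -> Clim (fun n => u n + v n) (l + m).
Proof.
  intros Hu Hv. apply (Clim_le _ _ (fun n => Cmod (u n - l) + Cmod (v n - m))%R).
  - intros n. replace (u n + v n - (l + m)) with ((u n - l) + (v n - m)) by ring.
    apply Cmod_triangle.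
  - rewrite <- (Rplus_0_l 0). now apply is_lim_seq_plus'.
Qed.

Lemma Clim_bounded (u : nat -> C) l : Clim u l -> exists B, forall n, (Cmod (u n) <= B)%R.
Proof.
  intros H. destruct (filterlim_bounded (V := C_NormedModule) u) as [B HB].
  - exists l. now apply Clim_filterlim.
  - exists B. exact HB.
Qed.

Lemma Clim_mult (u v : nat -> C) l m :
  Clim u l -> Clim v m -> Clim (fun n => u n * v n) (l * m).
Proof.
  intros Hu Hv. destruct (Clim_bounded _ _ Hv) as [B HB].
  apply (Clim_le _ _ (fun n => Cmod (u n - l) * B + Cmod l * Cmod (v n - m))%R).
  - intros n. replace (u n * v n - l * m) with ((u n - l) * v n + l * (v n - m)) by ring.
    eapply Rle_trans; [apply Cmod_triangle|]. rewrite !Cmod_mult.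
    apply Rplus_le_compat_r, Rmult_le_compat_l; [apply Cmod_ge_0 | apply HB].
  - replace 0%R with (0 * B + Cmod l * 0)%R by ring.
    apply is_lim_seq_plus'; apply is_lim_seq_mult'; auto using is_lim_seq_const.
Qed.

Lemma Clim_subseq (u : nat -> C) l (phi : nat -> nat) (k : nat) :
  (forall n, (n <= phi n + k)%nat) -> Clim u l -> Clim (fun n => u (phi n)) l.
Proof.
  intros H Hu. apply (is_lim_seq_subseq (fun n => Cmod (u n - l)) 0%R phi); [|exact Hu].
  intros P [N HN]. exists (N + k)%nat. intros n Hn. apply HN.
  specialize (H n). lia.
Qed.

(** A limit 0 would make 1 = |u n| |1 / u n| <= |u n| B tend to 0. This shows that an infinite
    product is nonzero without logarithms. *)
Lemma Clim_neq0 (u : nat -> C) l B :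
  (forall n, u n <> 0) -> (forall n, (Cmod (/ u n) <= B)%R) -> Clim u l -> l <> 0.
Proof.
  intros Hn HB Hu ->.
  assert (L : Rbar_le 1%R (0 * B)%R).
  { apply (is_lim_seq_le (fun _ => 1%R) (fun n => Cmod (u n - 0) * B)%R).
    - intros n. replace (u n - 0) with (u n) by ring.
      rewrite <- Cmod_1, <- (Cinv_r (u n)), Cmod_mult by apply Hn.
      apply Rmult_le_compat_l; [apply Cmod_ge_0 | apply HB].
    - apply is_lim_seq_const.
    - apply is_lim_seq_mult'; [exact Hu | apply is_lim_seq_const]. }
  simpl in L. lra.
Qed.

Lemma Clim_inv (u : nat -> C) l B :
  (forall n, u n <> 0) -> (forall n, (Cmod (/ u n) <= B)%R) -> Clim u l ->
  Clim (fun n => / u n) (/ l).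
Proof.
  intros Hn HB Hu. pose proof (Clim_neq0 u l B Hn HB Hu) as Hl.
  apply (Clim_le _ _ (fun n => (B * Cmod (/ l)) * Cmod (u n - l))%R).
  - intros n. replace (/ u n - / l) with (- ((/ u n * / l) * (u n - l))).
    2:{ field. auto. }
    rewrite Cmod_opp, !Cmod_mult. apply Rmult_le_compat_r; [apply Cmod_ge_0|].
    apply Rmult_le_compat_r; [apply Cmod_ge_0 | apply HB].
  - rewrite <- (Rmult_0_r (B * Cmod (/ l))).
    apply is_lim_seq_mult'; [apply is_lim_seq_const | exact Hu].
Qed.

Lemma is_series_Clim (a : nat -> C) (l : C) :
  is_series (K := C_AbsRing) (V := C_NormedModule) a l <-> Clim (Csum_to a) l.
Proof.
  rewrite Clim_filterlim. unfold is_series.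
  assert (E : forall n, sum_n (G := C_NormedModule) a n = Csum_to a n).
  { induction n as [|n IH]; [now rewrite sum_O|]. rewrite sum_Sn, IH. reflexivity. }
  split; apply filterlim_ext; intros n; now rewrite E.
Qed.

Definition geom_bounded (t : nat -> C) : Prop :=
  exists c x : R, (0 <= c)%R /\ (0 <= x < 1)%R /\ forall n, (Cmod (t n) <= c * x ^ n)%R.

Lemma geom_bounded_Clim (t : nat -> C) : geom_bounded t -> exists l, Clim (Csum_to t) l.
Proof.
  intros (c & x & Hc & Hx & Ht).
  destruct (ex_series_le (K := C_AbsRing) (V := C_CompleteNormedModule) t
    (fun n => c * x ^ n)%R) as [l Hl].
  - exact Ht.
  - apply (ex_series_scal c (fun n => x ^ n)%R). apply ex_series_geom.
    rewrite Rabs_pos_eq; lra.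
  - exists l. now apply is_series_Clim.
Qed.

Lemma geom_bounded_plus (t u : nat -> C) :
  geom_bounded t -> geom_bounded u -> geom_bounded (fun n => t n + u n).
Proof.
  intros (c & x & Hc & Hx & Ht) (d & y & Hd & Hy & Hu).
  exists (c + d)%R, (Rmax x y). split; [lra|]. split.
  { split; [apply (Rle_trans _ x); [lra | apply Rmax_l] | now apply Rmax_lub_lt]. }
  intros n. eapply Rle_trans; [apply Cmod_triangle|].
  rewrite Rmult_plus_distr_r. apply Rplus_le_compat.
  - eapply Rle_trans; [apply Ht|]. apply Rmult_le_compat_l; [easy|].
    apply pow_incr. split; [lra | apply Rmax_l].
  - eapply Rle_trans; [apply Hu|]. apply Rmult_le_compat_l; [easy|].
    apply pow_incr. split; [lra | apply Rmax_r].
Qed.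

Lemma geom_bounded_shift (t : nat -> C) :
  geom_bounded t -> geom_bounded (fun n => t (S n)).
Proof.
  intros (c & x & Hc & Hx & Ht). exists c, x. split; [easy|]. split; [easy|].
  intros n. eapply Rle_trans; [apply Ht|]. apply Rmult_le_compat_l; [easy|].
  simpl. pose proof (pow_le x n (proj1 Hx)). nra.
Qed.

(** Because all columns have the same limit [l], writing c = l + (c - l) separates the main term T l
    from an error. The error is small on a fixed head by the columnwise limits, and on the tail by
    the geometric majorant of [t]. *)
Lemma tannery (t : nat -> C) (c : nat -> nat -> C) (K : R) (l T : C) :
  geom_bounded t ->
  (forall N n, (n <= N)%nat -> (Cmod (c N n) <= K)%R) ->
  (forall n, Clim (fun N => c N n) l) ->
  Clim (Csum_to t) T ->
  Clim (fun N => Csum_to (fun n => t n * c N n) N) (T * l).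
Proof.
  intros (b & x & Hb & Hx & Ht) HK Hc HT.
  set (K' := (Rabs K + Cmod l)%R).
  assert (HK' : (0 <= K')%R) by (unfold K'; pose proof (Rabs_pos K); pose proof (Cmod_ge_0 l); lra).
  assert (Hd : forall N n, (n <= N)%nat -> (Cmod (c N n - l) <= K')%R).
  { intros N n Hn. unfold Cminus, K'. eapply Rle_trans; [apply Cmod_triangle|].
    rewrite Cmod_opp. pose proof (HK N n Hn). pose proof (Rle_abs K). lra. }
  assert (Hhead : forall M, is_lim_seq (fun N => sum_f_R0 (fun n => Cmod (c N n - l)) M) 0%R).
  { induction M as [|M IH]; simpl; [apply Hc|].
    rewrite <- (Rplus_0_l 0). apply is_lim_seq_plus'; [apply IH | apply Hc]. }
  assert (Hx1 : forall n, (0 <= x ^ n <= 1)%R).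
  { intros n. split; [now apply pow_le|]. rewrite <- (pow1 n). apply pow_incr. lra. }
  (* Head up to [M], followed by [k] tail terms summed as a finite geometric series. The tail length
     is explicit because [c N n] is bounded only for [n <= N]. *)
  assert (Hsplit : forall N M k, (M + k <= N)%nat ->
    (Cmod (Csum_to (fun n => t n * (c N n - l))%C (M + k))
     <= b * sum_f_R0 (fun n => Cmod (c N n - l)) M
        + K' * b * (x ^ S M * ((1 - x ^ k) / (1 - x))))%R).
  { intros N M k. induction k as [|k IHk]; intros Hk.
    - rewrite Nat.add_0_r. simpl (x ^ 0)%R.
      replace ((1 - 1) / (1 - x))%R with 0%R by (field; lra).
      rewrite !Rmult_0_r, Rplus_0_r. clear Hk. induction M as [|M IHM].
      + simpl. rewrite Cmod_mult. apply Rmult_le_compat_r; [apply Cmod_ge_0|].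
        specialize (Ht O). simpl in Ht. lra.
      + rewrite Csum_S. simpl sum_f_R0. rewrite Rmult_plus_distr_l.
        eapply Rle_trans; [apply Cmod_triangle|]. apply Rplus_le_compat; [easy|].
        rewrite Cmod_mult. apply Rmult_le_compat_r; [apply Cmod_ge_0|].
        eapply Rle_trans; [apply Ht|]. pose proof (Hx1 (S M)). nra.
    - rewrite Nat.add_succ_r, Csum_S.
      eapply Rle_trans; [apply Cmod_triangle|].
      eapply Rle_trans; [apply Rplus_le_compat; [apply IHk; lia|]|].
      + rewrite Cmod_mult. apply Rmult_le_compat; [apply Cmod_ge_0 .. | apply Ht | apply Hd; lia].
      + right. replace (S (M + k)) with (S M + k)%nat by lia.
        rewrite (pow_add x). simpl. field. lra. }
  apply (Clim_ext (fun N => Csum_to t N * l + Csum_to (fun n => t n * (c N n - l)) N)).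
  { intros N. rewrite (Cmult_comm _ l), <- Csum_scal, <- Csum_plus.
    apply Csum_ext. intros. ring. }
  replace (T * l) with (T * l + 0) by ring.
  apply Clim_plus; [apply Clim_mult; [easy | apply Clim_const]|].
  apply is_lim_seq_spec. intros eps.
  assert (Htail : is_lim_seq (fun M => (K' * b / (1 - x)) * (x * x ^ M))%R 0%R).
  { replace 0%R with ((K' * b / (1 - x)) * (x * 0))%R by ring.
    apply is_lim_seq_mult'; [apply is_lim_seq_const|].
    apply is_lim_seq_mult'; [apply is_lim_seq_const|].
    apply is_lim_seq_geom. rewrite Rabs_pos_eq; lra. }
  apply is_lim_seq_spec in Htail.
  destruct (Htail (pos_div_2 eps)) as [M HM]. specialize (HM M (le_n _)).
  assert (Hh := Hhead M). apply (is_lim_seq_scal_l _ b) in Hh.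
  simpl in Hh. rewrite Rmult_0_r in Hh.
  apply is_lim_seq_spec in Hh. destruct (Hh (pos_div_2 eps)) as [N0 HN0].
  exists (M + N0)%nat. intros N HN.
  specialize (HN0 N ltac:(lia)). specialize (Hsplit N M (N - M)%nat ltac:(lia)).
  replace (M + (N - M))%nat with N in Hsplit by lia.
  rewrite Rminus_0_r in *. rewrite (Rabs_pos_eq (Cmod _)) by apply Cmod_ge_0.
  replace (Csum_to (fun n => t n * (c N n - l)) N - 0)
    with (Csum_to (fun n => t n * (c N n - l)) N) by ring.
  eapply Rle_lt_trans; [exact Hsplit|].
  apply Rabs_def2 in HM. apply Rabs_def2 in HN0. simpl in HM, HN0.
  assert (Hle : (K' * b * (x ^ S M * ((1 - x ^ (N - M)) / (1 - x)))
     <= K' * b / (1 - x) * (x * x ^ M))%R).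
  { replace (K' * b / (1 - x) * (x * x ^ M))%R
      with (K' * b * (x ^ S M * (1 / (1 - x))))%R by (simpl; field; lra).
    apply Rmult_le_compat_l; [now apply Rmult_le_pos|].
    apply Rmult_le_compat_l; [apply Hx1|].
    apply Rmult_le_compat_r; [left; apply Rinv_0_lt_compat; lra|].
    pose proof (Hx1 (N - M)%nat). lra. }
  lra.
Qed.

(** By 1 + y <= exp y, the growth factors multiply to at most exp of a geometric sum. The bound
    depends only on [c] and [x], and serves both (a;p)_n and 1/(p;p)_n. *)
Lemma prod_bounded (c x : R) : (0 <= c)%R -> (0 <= x < 1)%R ->
  exists B, forall u : nat -> R, (u O <= 1)%R -> (forall n, (0 <= u n)%R) ->
    (forall n, (u (S n) <= u n * (1 + c * x ^ n))%R) -> forall n, (u n <= B)%R.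
Proof.
  intros Hc Hx. exists (exp (c / (1 - x))). intros u H0 Hp HS n.
  apply (Rle_trans _ (exp (c * ((1 - x ^ n) / (1 - x))))).
  - induction n as [|n IH].
    + simpl. replace (c * ((1 - 1) / (1 - x)))%R with 0%R by (field; lra).
      now rewrite exp_0.
    + eapply Rle_trans; [apply HS|].
      replace (c * ((1 - x ^ S n) / (1 - x)))%R
        with (c * ((1 - x ^ n) / (1 - x)) + c * x ^ n)%R by (simpl; field; lra).
      rewrite exp_plus. pose proof (pow_le x n (proj1 Hx)).
      apply Rmult_le_compat; auto; [nra|]. apply exp_ineq1_le.
  - assert (Hle : (c * ((1 - x ^ n) / (1 - x)) <= c / (1 - x))%R).
    { apply Rmult_le_compat_l; [easy|]. rewrite <- (Rmult_1_l (/ (1 - x))).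
      apply Rmult_le_compat_r; [left; apply Rinv_0_lt_compat; lra|].
      pose proof (pow_le x n (proj1 Hx)). lra. }
    destruct Hle as [Hlt | ->]; [left; now apply exp_increasing | apply Rle_refl].
Qed.

Lemma qpoch_bounded (a p : C) : (Cmod p < 1)%R ->
  exists B, forall n, (Cmod (qpoch a p n) <= B)%R.
Proof.
  intros H. destruct (prod_bounded (Cmod a) (Cmod p)) as [B HB].
  - apply Cmod_ge_0.
  - split; [apply Cmod_ge_0 | easy].
  - exists B. apply HB.
    + simpl. rewrite Cmod_1. lra.
    + intros n. apply Cmod_ge_0.
    + intros n. rewrite qpoch_S, Cmod_mult.
      apply Rmult_le_compat_l; [apply Cmod_ge_0|].
      unfold Cminus. eapply Rle_trans; [apply Cmod_triangle|].
      rewrite Cmod_opp, Cmod_1, Cmod_mult, Cmod_pow. lra.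
Qed.

Lemma qpoch_inv_bounded (p : C) : (Cmod p < 1)%R ->
  exists B, forall n, (Cmod (/ qpoch p p n) <= B)%R.
Proof.
  intros H. pose proof (Cmod_ge_0 p) as H0.
  (* Origin of the constant: for x = |p| and 0 <= y <= 1, 1/(1 - x y) = 1 + x y/(1 - x y) <= 1 +
     (x/(1 - x)) y, applied with y = x^n. *)
  assert (Hc : (0 <= Cmod p / (1 - Cmod p))%R) by (apply Rdiv_le_0_compat; lra).
  destruct (prod_bounded _ _ Hc (conj H0 H)) as [B HB].
  exists B. apply HB.
  - simpl. replace (/ 1) with (RtoC 1) by (field; apply C1_nz). rewrite Cmod_1. lra.
  - intros n. apply Cmod_ge_0.
  - intros n. rewrite qpoch_S.
    replace (/ (qpoch p p n * (1 - p * p ^ n))) with (/ qpoch p p n * / (1 - p * p ^ n)).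
    2:{ field. auto with qs. }
    rewrite Cmod_mult. apply Rmult_le_compat_l; [apply Cmod_ge_0|].
    rewrite Cmod_inv by auto with qs.
    assert (Hx : (0 <= Cmod p ^ n <= 1)%R).
    { split; [now apply pow_le|]. rewrite <- (pow1 n). apply pow_incr. lra. }
    assert (Hy : (1 - Cmod p * Cmod p ^ n <= Cmod (1 - p * p ^ n))%R).
    { rewrite <- Cmod_pow, <- Cmod_mult.
      assert (T : (Cmod 1 <= Cmod (1 - p * p ^ n) + Cmod (p * p ^ n))%R).
      { replace (RtoC 1) with ((1 - p * p ^ n) + p * p ^ n) at 1 by ring.
        apply Cmod_triangle. }
      rewrite Cmod_1 in T. lra. }
    revert Hx Hy. generalize (Cmod p ^ n)%R. intros y Hx Hy.
    apply (Rle_trans _ (/ (1 - Cmod p * y))).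
    + apply Rinv_le_contravar; [nra | easy].
    + assert (Hpos : (0 < 1 - Cmod p * y)%R) by nra.
      apply (Rmult_le_reg_r _ _ _ Hpos). rewrite Rinv_l by lra.
      apply (Rmult_le_reg_r (1 - Cmod p)); [lra|].
      replace ((1 + Cmod p / (1 - Cmod p) * y) * (1 - Cmod p * y) * (1 - Cmod p))%R
        with ((1 - Cmod p + Cmod p * y) * (1 - Cmod p * y))%R by (field; lra).
      assert (0 <= Cmod p * Cmod p * (y * (1 - y)))%R by (apply Rmult_le_pos; nra).
      nra.
Qed.

(** [lim] is a total function that means something only on Cauchy filters; the assumed limit [l]
    supplies the Cauchy property, and uniqueness of limits identifies the values. *)
Lemma qpoch_inf_unique (a p l : C) : Clim (qpoch a p) l -> qpoch_inf a p = l.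
Proof.
  intros H. apply (Clim_unique (qpoch a p)); [|exact H].
  apply Clim_filterlim in H. apply Clim_filterlim.
  apply (proj2 (filterlim_locally (U := C_NormedModule) (qpoch a p) (qpoch_inf a p))).
  intros eps. unfold qpoch_inf.
  apply (complete_cauchy (T := C_CompleteNormedModule)).
  - apply (filtermap_proper_filter _ _ (qpoch a p) eventually). apply eventually_filter.
  - intros e. exists l. exact (proj1 (filterlim_locally (U := C_NormedModule) (qpoch a p) l) H e).
Qed.

Lemma qpoch_inf_correct (a p : C) : (Cmod p < 1)%R -> Clim (qpoch a p) (qpoch_inf a p).
Proof.
  intros H. destruct (qpoch_bounded a p H) as [B HB].
  pose proof (Cmod_ge_0 p) as H0. pose proof (Cmod_ge_0 a) as Ha.
  assert (HB0 : (0 <= B)%R) by (apply (Rle_trans _ _ _ (Cmod_ge_0 _) (HB O))).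
  (* These terms are the differences (a;p)_(n+1) - (a;p)_n, geometrically small since (a;p)_n is
     bounded. Their series telescopes, which proves convergence of the product. *)
  destruct (geom_bounded_Clim (fun n => - (qpoch a p n * (a * p ^ n)))) as [l Hl].
  { exists (B * Cmod a)%R, (Cmod p). split; [now apply Rmult_le_pos|]. split; [lra|].
    intros n. rewrite Cmod_opp, !Cmod_mult, Cmod_pow, Rmult_assoc.
    apply Rmult_le_compat_r; [|apply HB].
    apply Rmult_le_pos; [easy | now apply pow_le]. }
  assert (L : Clim (qpoch a p) (1 + l)).
  { apply (is_lim_seq_incr_1 (fun n => Cmod (qpoch a p n - (1 + l)))).
    apply (Clim_ext (fun n => 1 + Csum_to (fun n => - (qpoch a p n * (a * p ^ n))) n)).
    - induction n as [|n IH].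
      + simpl. ring.
      + rewrite Csum_S, Cplus_assoc, IH, (qpoch_S a p (S n)). ring.
    - apply Clim_plus; [apply Clim_const | exact Hl]. }
  now rewrite (qpoch_inf_unique a p _ L).
Qed.

Lemma qpoch_inf_neq0 (p : C) : (Cmod p < 1)%R -> qpoch_inf p p <> 0.
Proof.
  intros H. destruct (qpoch_inv_bounded p H) as [B HB].
  apply (Clim_neq0 (qpoch p p) _ B); auto with qs. now apply qpoch_inf_correct.
Qed.

Lemma qpoch_inv_Clim (p : C) : (Cmod p < 1)%R ->
  Clim (fun n => / qpoch p p n) (/ qpoch_inf p p).
Proof.
  intros H. destruct (qpoch_inv_bounded p H) as [B HB].
  apply (Clim_inv (qpoch p p) _ B); auto with qs. now apply qpoch_inf_correct.
Qed.

Lemma theta_term_geom_bounded (z s : C) :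
  (Cmod z < 1)%R -> (Cmod s < 1)%R -> geom_bounded (theta_term z s).
Proof.
  intros Hz Hs. exists 1%R, (Cmod z). split; [lra|]. split.
  { split; [apply Cmod_ge_0 | easy]. }
  intros n. unfold theta_term. rewrite Cmod_mult, Cmod_pow, Cmod_opp, Rmult_comm.
  apply Rmult_le_compat_r; [apply pow_le, Cmod_ge_0 | now apply Cmod_pow_le1].
Qed.

Lemma Csum_shift_Clim (t : nat -> C) l :
  Clim (Csum_to t) l -> Clim (Csum_to (fun n => t (S n))) (l - t O).
Proof.
  intros H. apply (Clim_ext (fun n => Csum_to t (S n) + - t O)).
  - intros n. rewrite Csum_shift. ring.
  - apply Clim_plus; [|apply Clim_const].
    apply (Clim_subseq _ _ S 0); [lia | exact H].
Qed.

(** Limit of the symmetric finite form: each q-binomial coefficient at a fixed distance from the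
    centre tends to 1/(s;s)_oo. Both [A] and [B] contain the term of index 0, hence the -1. *)
Lemma jacobi_triple_product (z y s A B : C) :
  (Cmod z < 1)%R -> (Cmod y < 1)%R -> (Cmod s < 1)%R -> z * y = s ->
  Clim (Csum_to (theta_term z s)) A -> Clim (Csum_to (theta_term y s)) B ->
  A + B - 1 = qpoch_inf z s * qpoch_inf y s * qpoch_inf s s.
Proof.
  intros Hz Hy H Hzy HA HB.
  pose proof (qpoch_inf_neq0 s H) as Hn.
  destruct (qpoch_bounded s s H) as [K1 HK1].
  destruct (qpoch_inv_bounded s H) as [K2 HK2].
  (* The q-binomial coefficient at distance r + 1 from the centre S N of row 2N + 2, the same on
     both sides. *)
  set (c := fun N r => qpoch s s (S N + S N) * (/ qpoch s s (S N + S r) * / qpoch s s (N - r))).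
  assert (Hc : forall r, Clim (fun N => c N r) (/ qpoch_inf s s)).
  { intros r. replace (/ qpoch_inf s s)
      with (qpoch_inf s s * (/ qpoch_inf s s * / qpoch_inf s s)) by (field; auto).
    apply Clim_mult; [|apply Clim_mult].
    - apply (Clim_subseq (qpoch s s) _ (fun N => S N + S N)%nat 0); [lia|].
      now apply qpoch_inf_correct.
    - apply (Clim_subseq (fun n => / qpoch s s n) _ (fun N => S N + S r)%nat 0); [lia|].
      now apply qpoch_inv_Clim.
    - apply (Clim_subseq (fun n => / qpoch s s n) _ (fun N => N - r)%nat r); [lia|].
      now apply qpoch_inv_Clim. }
  assert (Hcb : forall N r, (r <= N)%nat -> (Cmod (c N r) <= K1 * (K2 * K2))%R).
  { intros N r _. unfold c. rewrite !Cmod_mult.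
    apply Rmult_le_compat; [apply Cmod_ge_0 | | apply HK1 |].
    - apply Rmult_le_pos; apply Cmod_ge_0.
    - apply Rmult_le_compat; auto using Cmod_ge_0. }
  assert (Ht : forall x X, (Cmod x < 1)%R -> Clim (Csum_to (theta_term x s)) X ->
    Clim (fun N => Csum_to (fun r => theta_term x s (S r) * c N r) N)
      ((X - 1) * / qpoch_inf s s)).
  { intros x X Hx HX. apply (tannery (fun r => theta_term x s (S r)) c (K1 * (K2 * K2))); auto.
    - now apply geom_bounded_shift, theta_term_geom_bounded.
    - rewrite <- (theta_term_0 x s). now apply (Csum_shift_Clim (theta_term x s)). }
  assert (Hmid : Clim (fun N => qbinom s (S N + S N) (S N)) (/ qpoch_inf s s)).
  { apply (Clim_ext (fun N => qpoch s s (S N + S N) * (/ qpoch s s (S N) * / qpoch s s (S N)))).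
    - intros N. rewrite qbinom_eq. field. auto with qs.
    - replace (/ qpoch_inf s s)
        with (qpoch_inf s s * (/ qpoch_inf s s * / qpoch_inf s s)) by (field; auto).
      apply Clim_mult; [|apply Clim_mult].
      + apply (Clim_subseq (qpoch s s) _ (fun N => S N + S N)%nat 0); [lia|].
        now apply qpoch_inf_correct.
      + apply (Clim_subseq (fun n => / qpoch s s n) _ S 0); [lia|].
        now apply qpoch_inv_Clim.
      + apply (Clim_subseq (fun n => / qpoch s s n) _ S 0); [lia|].
        now apply qpoch_inv_Clim. }
  assert (L1 := Clim_plus _ _ _ _ Hmid (Clim_plus _ _ _ _ (Ht z A Hz HA) (Ht y B Hy HB))).
  assert (L2 : Clim (fun N => qpoch z s (S N) * qpoch y s (S N)) (qpoch_inf z s * qpoch_inf y s)).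
  { apply (Clim_subseq (fun n => qpoch z s n * qpoch y s n) _ S 0); [lia|].
    apply Clim_mult; now apply qpoch_inf_correct. }
  enough (E : forall N, qbinom s (S N + S N) (S N)
      + (Csum_to (fun r => theta_term z s (S r) * c N r) N
         + Csum_to (fun r => theta_term y s (S r) * c N r) N)
      = qpoch z s (S N) * qpoch y s (S N)).
  { rewrite <- (Clim_unique _ _ _ (Clim_ext _ _ _ E L1) L2). field. auto. }
  intros N. rewrite <- jacobi_triple_product_fin, Csum_fold, <- Csum_plus by easy.
  rewrite Nat.sub_diag, !theta_term_0. f_equal; [ring|].
  apply Csum_ext; intros r Hr.
  replace (S N + S r - S N)%nat with (S r) by lia.
  replace (S N - (S N + S r))%nat with O by lia.
  replace (N - r - S N)%nat with O by lia.
  replace (S N - (N - r))%nat with (S r) by lia.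
  rewrite !theta_term_0.
  rewrite (qbinom_split s _ (S N + S r) (N - r)), (qbinom_split s _ (N - r) (S N + S r)) by lia.
  unfold c.
  field. auto with qs.
Qed.

Lemma geom_bounded_ext (t u : nat -> C) :
  (forall n, t n = u n) -> geom_bounded t -> geom_bounded u.
Proof.
  intros E (c & x & Hc & Hx & Ht). exists c, x. split; [easy|]. split; [easy|].
  intros n. now rewrite <- E.
Qed.

(** Groups the bilateral indices r and -(r+1). This is the shape coming from pairs relative to a =
    q, where 1 - p^(2r+1) splits each [alpha r] into two theta terms. *)
Lemma jacobi_triple_product_odd (z y s : C) :
  (Cmod z < 1)%R -> (Cmod y < 1)%R -> (Cmod s < 1)%R -> z * y = s ->
  geom_bounded (fun r => theta_term z s r + theta_term y s (S r)) /\
  Clim (Csum_to (fun r => theta_term z s r + theta_term y s (S r)))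
    (qpoch_inf z s * qpoch_inf y s * qpoch_inf s s).
Proof.
  intros Hz Hy H Hzy.
  pose proof (theta_term_geom_bounded z s Hz H) as Gz.
  pose proof (theta_term_geom_bounded y s Hy H) as Gy.
  split; [now apply geom_bounded_plus, geom_bounded_shift|].
  destruct (geom_bounded_Clim _ Gz) as [A HA]. destruct (geom_bounded_Clim _ Gy) as [B HB].
  rewrite <- (jacobi_triple_product z y s A B) by easy.
  apply (Clim_ext (fun n => Csum_to (theta_term z s) n
    + Csum_to (fun r => theta_term y s (S r)) n)).
  { intros n. symmetry. apply Csum_plus. }
  replace (A + B - 1) with (A + (B - 1)) by ring.
  apply Clim_plus; [easy|]. rewrite <- (theta_term_0 y s).
  now apply (Csum_shift_Clim (theta_term y s)).
Qed.

(** Groups the indices r and -r, with index 0 alone: the shape coming from pairs relative to a =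
    1. *)
Lemma jacobi_triple_product_even (z y s : C) :
  (Cmod z < 1)%R -> (Cmod y < 1)%R -> (Cmod s < 1)%R -> z * y = s ->
  let a := fun r => match r with O => RtoC 1 | S _ => theta_term z s r + theta_term y s r end in
  geom_bounded a /\
  Clim (Csum_to a) (qpoch_inf z s * qpoch_inf y s * qpoch_inf s s).
Proof.
  intros Hz Hy H Hzy a.
  pose proof (theta_term_geom_bounded z s Hz H) as Gz.
  pose proof (theta_term_geom_bounded y s Hy H) as Gy.
  set (d := fun r : nat => match r with O => - (1) | S _ => RtoC 0 end).
  assert (E : forall r, theta_term z s r + theta_term y s r + d r = a r).
  { intros [|r]; unfold d, a; [rewrite !theta_term_0|]; ring. }
  split.
  - apply (geom_bounded_ext _ _ E).
    apply geom_bounded_plus; [now apply geom_bounded_plus|].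
    exists 1%R, 0%R. split; [lra|]. split; [lra|]. intros [|n]; simpl.
    + rewrite Cmod_opp, Cmod_1. lra.
    + rewrite Cmod_0. lra.
  - destruct (geom_bounded_Clim _ Gz) as [A HA]. destruct (geom_bounded_Clim _ Gy) as [B HB].
    rewrite <- (jacobi_triple_product z y s A B) by easy.
    apply (Clim_ext (fun n => Csum_to (theta_term z s) n + Csum_to (theta_term y s) n + - (1))).
    { induction n as [|n IH].
      - simpl. rewrite !theta_term_0. ring.
      - rewrite !Csum_S, <- IH. unfold a. ring. }
    apply Clim_plus; [now apply Clim_plus | apply Clim_const].
Qed.

(** * Bailey pairs and their limiting sums *)

(** Common endgame of the five identities, with tau = -sigma. The product on the [alpha] side must
    separate into [cN N], free of [r], and theta terms [a r], free of [N]. The limits of the two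
    sides are T/(p;p)_oo and c A/(p;p)_oo^2, whence the single denominator in the result. *)
Lemma bailey_series (p rho tau : C) (e : nat) (alpha beta a cN : nat -> C) (c A : C) :
  (Cmod p < 1)%R -> (Cmod tau < 1)%R -> rho * - tau = p ^ (1 + e) ->
  bailey_pair p e alpha beta -> (exists K, forall n, (Cmod (beta n) <= K)%R) ->
  (forall N r, (r <= N)%nat -> alpha r * (qpoch rho p r * tau ^ r * p ^ tri r
     * qpoch (- tau * p ^ r) p (N - r)) = cN N * a r) ->
  Clim cN c -> geom_bounded a /\ Clim (Csum_to a) A ->
  Clim (Csum_to (fun n => qpoch rho p n * tau ^ n * p ^ tri n * beta n))
    (c * A / qpoch_inf p p).
Proof.
  intros H Htau Hrs Hb [K HK] Ha Hc [Ga HA].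
  destruct (qpoch_bounded rho p H) as [R HR].
  destruct (qpoch_inv_bounded p H) as [P HP].
  destruct (Clim_bounded _ _ Hc) as [B HB].
  assert (Hnn : forall (f : nat -> C) D, (forall n, (Cmod (f n) <= D)%R) -> (0 <= D)%R).
  { intros f D Hf. apply (Rle_trans _ _ _ (Cmod_ge_0 (f O)) (Hf O)). }
  pose proof (Hnn _ _ HK) as HK0. pose proof (Hnn _ _ HR) as HR0.
  pose proof (Hnn _ _ HP) as HP0. pose proof (Hnn _ _ HB) as HB0.
  set (t := fun n => qpoch rho p n * tau ^ n * p ^ tri n * beta n).
  assert (Gt : geom_bounded t).
  { exists (R * K)%R, (Cmod tau). split; [now apply Rmult_le_pos|].
    split; [split; [apply Cmod_ge_0 | easy]|].
    intros n. unfold t. rewrite !Cmod_mult, Cmod_pow.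
    pose proof (Cmod_pow_le1 p (tri n) H). pose proof (HR n). pose proof (HK n).
    pose proof (pow_le (Cmod tau) n (Cmod_ge_0 _)).
    replace (R * K * Cmod tau ^ n)%R with (R * Cmod tau ^ n * 1 * K)%R by ring.
    repeat (apply Rmult_le_compat; try apply Cmod_ge_0; try easy; try apply Rle_refl;
      repeat (apply Rmult_le_pos; try apply Cmod_ge_0; try easy)). }
  destruct (geom_bounded_Clim t Gt) as [T HT].
  pose proof (qpoch_inf_neq0 p H) as Hn.
  assert (Hinv : forall r, Clim (fun N => / qpoch p p (N - r)) (/ qpoch_inf p p)).
  { intros r. apply (Clim_subseq (fun n => / qpoch p p n) _ (fun N => N - r)%nat r); [lia|].
    now apply qpoch_inv_Clim. }
  assert (L1 : Clim (fun N => Csum_to (fun n => t n * / qpoch p p (N - n)) N)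
    (T * / qpoch_inf p p)).
  { apply (tannery t (fun N n => / qpoch p p (N - n)) P); auto. }
  set (cc := fun N r => cN N * (/ qpoch p p (N - r) * / qpoch p p (N + r + e))).
  assert (L2 : Clim (fun N => Csum_to (fun r => a r * cc N r) N)
    (A * (c * (/ qpoch_inf p p * / qpoch_inf p p)))).
  { apply (tannery a cc (B * (P * P))%R); auto.
    - intros N r _. unfold cc. rewrite !Cmod_mult.
      apply Rmult_le_compat; auto using Cmod_ge_0.
      + apply Rmult_le_pos; apply Cmod_ge_0.
      + apply Rmult_le_compat; auto using Cmod_ge_0.
    - intros r. apply Clim_mult; [easy|]. apply Clim_mult; [apply Hinv|].
      apply (Clim_subseq (fun n => / qpoch p p n) _ (fun N => N + r + e)%nat 0); [lia|].
      now apply qpoch_inv_Clim. }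
  assert (E : forall N, Csum_to (fun n => t n * / qpoch p p (N - n)) N
    = Csum_to (fun r => a r * cc N r) N).
  { intros N. pose proof (bailey_rho_step p rho (- tau) e alpha beta N H Hrs Hb) as E.
    replace (- - tau) with tau in E by ring. unfold Cdiv in E at 1. unfold t. rewrite E.
    apply Csum_ext; intros r Hr. rewrite (Ha N r Hr). unfold cc. field. auto with qs. }
  pose proof (Clim_unique _ _ _ (Clim_ext _ _ _ E L1) L2) as F.
  replace (c * A / qpoch_inf p p) with T; [exact HT|].
  replace T with (T * / qpoch_inf p p * qpoch_inf p p) by (field; easy).
  rewrite F. field. easy.
Qed.

Lemma bailey_pair_ext (p : C) e (al al' be be' : nat -> C) :
  (forall n, al n = al' n) -> (forall n, be n = be' n) ->
  bailey_pair p e al be -> bailey_pair p e al' be'.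
Proof.
  intros Ea Eb Hb n. rewrite <- Eb, (Hb n). apply Csum_ext; intros. now rewrite Ea.
Qed.

(** One step applied to the unit pair: only i = 0 survives in the new [beta]. The exponent is the
    pentagonal number r(3r+1)/2. *)
Lemma bailey_pair_inv_qpoch (p : C) : (Cmod p < 1)%R ->
  bailey_pair p 1 (fun r => (- (1)) ^ r * p ^ (tri r + r * r + r) * (1 - p ^ (2 * r + 1)))
    (fun n => / qpoch p p n).
Proof.
  intros H. refine (bailey_pair_ext _ _ _ _ _ _ _ _ (bailey_step _ _ _ _ H (unit_bailey_pair p H))).
  - intros r. replace (tri r + r * r + r)%nat with (r * r + 1 * r + tri r)%nat by lia.
    rewrite (Cpow_add_r p _ (tri r)). ring.
  - intros [|n].
    + simpl. field.
    + rewrite Csum_shift, (Csum_ext _ (fun _ => 0 * 0)) by (intros; unfold Cdiv; ring).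
      rewrite Csum_scal, Nat.sub_0_r. simpl (p ^ _). field. auto with qs.
Qed.

(** The inner sum divided by (p;p)_n, in the form in which [bailey_step] produces it from 1/(p;p)_n.
    As n grows, the inner sum itself tends to a Rogers-Ramanujan series. *)
Definition rr_beta (p : C) (e n : nat) : C :=
  Csum_to (fun i => p ^ (i * i + e * i) * / qpoch p p i / qpoch p p (n - i)) n.

Lemma rr_beta_bounded (p : C) e : (Cmod p < 1)%R ->
  exists K, forall n, (Cmod (rr_beta p e n) <= K)%R.
Proof.
  intros H. destruct (qpoch_inv_bounded p H) as [B HB].
  pose proof (Cmod_ge_0 p) as H0.
  assert (HB0 : (0 <= B)%R) by apply (Rle_trans _ _ _ (Cmod_ge_0 _) (HB O)).
  exists (B * B * (1 / (1 - Cmod p)))%R. intros n. unfold rr_beta.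
  assert (G : forall (f : nat -> C) D m, (forall i, (Cmod (f i) <= D * Cmod p ^ i)%R) ->
    (Cmod (Csum_to f m) <= D * ((1 - Cmod p ^ S m) / (1 - Cmod p)))%R).
  { intros f D m Hf. induction m as [|m IH].
    - simpl. specialize (Hf O). simpl in Hf.
      replace ((1 - Cmod p * 1) / (1 - Cmod p))%R with 1%R by (field; lra). exact Hf.
    - rewrite Csum_S. eapply Rle_trans; [apply Cmod_triangle|].
      eapply Rle_trans; [apply Rplus_le_compat; [apply IH | apply Hf]|].
      right. simpl. field. lra. }
  eapply Rle_trans; [apply (G _ (B * B)%R)|].
  - intros i. unfold Cdiv. rewrite !Cmod_mult.
    replace (i * i + e * i)%nat with (i + (i * i - i + e * i))%nat by nia.
    rewrite Cpow_add_r, Cmod_mult, Cmod_pow.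
    pose proof (Cmod_pow_le1 p (i * i - i + e * i) H) as H1.
    replace (B * B * Cmod p ^ i)%R with (Cmod p ^ i * 1 * B * B)%R by ring.
    pose proof (pow_le (Cmod p) i H0).
    repeat (apply Rmult_le_compat; try apply Cmod_ge_0; try easy; try apply Rle_refl;
      repeat (apply Rmult_le_pos; try apply Cmod_ge_0; try easy)).
  - apply Rmult_le_compat_l; [now apply Rmult_le_pos|].
    apply Rmult_le_compat_r; [left; apply Rinv_0_lt_compat; lra|].
    pose proof (pow_le (Cmod p) (S n) H0). lra.
Qed.

Lemma rr_beta_qbinom (p : C) e n (f : nat -> C) : (Cmod p < 1)%R ->
  (forall i, f i = p ^ (i * i + e * i)) ->
  Csum_to (fun i => f i * qbinom p n i) n = qpoch p p n * rr_beta p e n.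
Proof.
  intros H Hf. unfold rr_beta. rewrite <- Csum_scal. apply Csum_ext; intros i Hi.
  rewrite (qbinom_split p n i (n - i)), Hf by lia. field. auto with qs.
Qed.

Lemma bailey_pair_rr_beta1 (p : C) : (Cmod p < 1)%R ->
  bailey_pair p 1 (fun r => (- (1)) ^ r * p ^ (tri r + 2 * (r * r) + 2 * r) * (1 - p ^ (2 * r + 1)))
    (rr_beta p 1).
Proof.
  intros H. refine (bailey_pair_ext _ _ _ _ _ _ _ _
    (bailey_step _ _ _ _ H (bailey_pair_inv_qpoch p H))); [|reflexivity].
  intros r. replace (tri r + 2 * (r * r) + 2 * r)%nat
    with (r * r + 1 * r + (tri r + r * r + r))%nat by lia.
  rewrite (Cpow_add_r p (r * r + 1 * r)). ring.
Qed.

Lemma bailey_pair_rr_beta1_lower (p : C) : (Cmod p < 1)%R ->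
  bailey_pair p 0 (fun r => match r with O => RtoC 1 | S s => (- (1)) ^ S s *
      (p ^ (tri r + 2 * (r * r) + 2 * r) + p ^ (2 * s + 1 + (tri s + 2 * (s * s) + 2 * s))) end)
    (rr_beta p 1).
Proof.
  intros H. refine (bailey_pair_ext _ _ _ _ _ _ _ _
    (bailey_pair_lower _ (fun r => (- (1)) ^ r * p ^ (tri r + 2 * (r * r) + 2 * r)) _ H
      (bailey_pair_rr_beta1 p H))); [|reflexivity].
  intros [|r]; [simpl; ring|].
  rewrite (Cpow_add_r p (2 * r + 1)), Cpow_S. ring.
Qed.

(** Here the parameter is lowered before the step, since the inner weight p^(i^2) belongs to e = 0.
    In the preceding lemma the weight p^(i^2+i) requires the step to come first. *)
Lemma bailey_pair_rr_beta0 (p : C) : (Cmod p < 1)%R ->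
  bailey_pair p 0 (fun r => match r with O => RtoC 1 | S s => (- (1)) ^ S s *
      (p ^ (r * r + (tri r + r * r + r)) + p ^ (r * r + (2 * s + 1 + (tri s + s * s + s)))) end)
    (rr_beta p 0).
Proof.
  intros H. refine (bailey_pair_ext _ _ _ _ _ _ _ _
    (bailey_step _ _ _ _ H (bailey_pair_lower _
      (fun r => (- (1)) ^ r * p ^ (tri r + r * r + r)) _ H
      (bailey_pair_inv_qpoch p H)))); [|reflexivity].
  intros [|r]; [simpl; ring|].
  rewrite (Nat.mul_0_l (S r)), Nat.add_0_r, !(Cpow_add_r p (S r * S r)),
    (Cpow_add_r p (2 * r + 1)), (Cpow_S (- (1))). ring.
Qed.

(** * Dissections of products and arithmetic of exponents *)

Lemma Cpow_opp (x : C) n : (- x) ^ n = (- (1)) ^ n * x ^ n.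
Proof. rewrite <- Cpow_mult_l. f_equal. ring. Qed.

Lemma theta_term_pow (q : C) a b r :
  theta_term (q ^ a) (q ^ b) r = (- (1)) ^ r * q ^ (a * r + b * tri r).
Proof. unfold theta_term. rewrite Cpow_opp, Cpow_add_r, !Cpow_mult_r. ring. Qed.

Lemma qpoch_split2 (a p : C) n :
  qpoch a p (2 * n) = qpoch a (p ^ 2) n * qpoch (a * p) (p ^ 2) n.
Proof.
  induction n as [|n IH]; [simpl; ring|].
  replace (2 * S n)%nat with (S (S (2 * n))) by lia. rewrite !qpoch_S, IH.
  rewrite (Cpow_S p (2 * n)), <- Cpow_mult_r. ring.
Qed.

Lemma qpoch_split3 (a p : C) n :
  qpoch a p (3 * n) = qpoch a (p ^ 3) n * qpoch (a * p) (p ^ 3) n * qpoch (a * p ^ 2) (p ^ 3) n.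
Proof.
  induction n as [|n IH]; [simpl; ring|].
  replace (3 * S n)%nat with (S (S (S (3 * n)))) by lia. rewrite !qpoch_S, IH.
  rewrite (Cpow_S p (S (3 * n))), (Cpow_S p (3 * n)), <- !Cpow_mult_r, (Cpow_S p 1), Cpow_1_r.
  ring.
Qed.

Lemma qpoch_opp (a p : C) n : qpoch a p n * qpoch (- a) p n = qpoch (a ^ 2) (p ^ 2) n.
Proof.
  induction n as [|n IH]; [simpl; ring|].
  rewrite !qpoch_S, <- IH.
  replace ((p ^ 2) ^ n) with (p ^ n * p ^ n)
    by (rewrite <- Cpow_add_r, <- Cpow_mult_r; f_equal; lia).
  rewrite (Cpow_S a 1), Cpow_1_r. ring.
Qed.

Lemma qpoch_inf_split2 (a p : C) : (Cmod p < 1)%R ->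
  qpoch_inf a p = qpoch_inf a (p ^ 2) * qpoch_inf (a * p) (p ^ 2).
Proof.
  intros H. apply (Clim_unique (fun n => qpoch a p (2 * n))).
  - apply (Clim_subseq (qpoch a p) _ (fun n => 2 * n)%nat 0); [lia|]. now apply qpoch_inf_correct.
  - apply (Clim_ext _ _ _ (fun n => eq_sym (qpoch_split2 a p n))).
    apply Clim_mult; apply qpoch_inf_correct; now apply (Cmod_pow_lt1 p 1).
Qed.

Lemma qpoch_inf_split3 (a p : C) : (Cmod p < 1)%R ->
  qpoch_inf a p
  = qpoch_inf a (p ^ 3) * qpoch_inf (a * p) (p ^ 3) * qpoch_inf (a * p ^ 2) (p ^ 3).
Proof.
  intros H. apply (Clim_unique (fun n => qpoch a p (3 * n))).
  - apply (Clim_subseq (qpoch a p) _ (fun n => 3 * n)%nat 0); [lia|]. now apply qpoch_inf_correct.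
  - apply (Clim_ext _ _ _ (fun n => eq_sym (qpoch_split3 a p n))).
    apply Clim_mult; [apply Clim_mult|]; apply qpoch_inf_correct; now apply (Cmod_pow_lt1 p 2).
Qed.

Lemma qpoch_inf_opp (a p : C) : (Cmod p < 1)%R ->
  qpoch_inf a p * qpoch_inf (- a) p = qpoch_inf (a ^ 2) (p ^ 2).
Proof.
  intros H. apply (Clim_unique (fun n => qpoch a p n * qpoch (- a) p n)).
  - apply Clim_mult; now apply qpoch_inf_correct.
  - apply (Clim_ext _ _ _ (fun n => eq_sym (qpoch_opp a p n))).
    apply qpoch_inf_correct. now apply (Cmod_pow_lt1 p 1).
Qed.

Lemma tri_div n : (n * (n + 1) / 2 = n + tri n)%nat.
Proof.
  replace (n * (n + 1))%nat with ((n + tri n) * 2)%nat by (pose proof (tri_double n); nia).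
  apply Nat.div_mul. lia.
Qed.

(** Squares in exponents are rewritten as 2 tri n + n, after which every exponent is a sum of copies
    of [tri n], [n] and constants, and [ring] can compare the powers. *)
Ltac qpow n :=
  rewrite ?theta_term_pow, <- ?Cpow_mult_r;
  rewrite <- ?(tri_double (S n)), <- ?(tri_double n);
  cbn [tri Nat.mul Nat.add];
  repeat (rewrite Cpow_add_r || rewrite Cpow_S);
  simpl; ring.

Lemma qpoch_cut (a p : C) r N : (r <= N)%nat ->
  qpoch a p N = qpoch a p r * qpoch (a * p ^ r) p (N - r).
Proof.
  intros H. replace N with (r + (N - r))%nat at 1 by lia. apply qpoch_add.
Qed.

(** * The five series *)

Lemma rr_series_mod6_3_3 (q : C) : (Cmod q < 1)%R ->
  Clim (Csum_to (fun n => qpoch (- (1)) q n * q ^ n * q ^ tri n * rr_beta q 0 n))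
    (qpoch_inf (- q) q * (qpoch_inf (q ^ 3) (q ^ 6) * qpoch_inf (q ^ 3) (q ^ 6)
       * qpoch_inf (q ^ 6) (q ^ 6)) / qpoch_inf q q).
Proof.
  intros H.
  refine (bailey_series _ _ _ _ _ _ _ (fun N => qpoch (- q) q N) _ _ H H _
    (bailey_pair_rr_beta0 q H) (rr_beta_bounded q 0 H) _ _
    (jacobi_triple_product_even (q ^ 3) (q ^ 3) (q ^ 6) _ _ _ _)).
  - simpl. ring.
  - intros N [|s] Hr.
    + rewrite Nat.sub_0_r. simpl. replace (- q * 1) with (- q) by ring. ring.
    (* For r = s + 1, (-1;q)_r = 2 (-q;q)_(r-1), and [alpha r] equals (-1)^r q^((5r^2-r)/2) (1 +
       q^r). The factor 1 + q^r completes (-q;q)_r, and the 2 accounts for the two equal theta terms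
       with z = y = q^3. *)
    + rewrite (qpoch_cut (- q) q (S s) N Hr), qpoch_Sl, (qpoch_S (- q)).
      replace (- (1) * q) with (- q) by ring.
      qpow s.
  - now apply qpoch_inf_correct.
  - now apply (Cmod_pow_lt1 q 2).
  - now apply (Cmod_pow_lt1 q 2).
  - now apply (Cmod_pow_lt1 q 5).
  - rewrite <- Cpow_add_r. reflexivity.
Qed.

Lemma rr_series_mod6_1_5 (q : C) : (Cmod q < 1)%R ->
  Clim (Csum_to (fun n => qpoch (- q) q n * q ^ n * q ^ tri n * rr_beta q 1 n))
    (qpoch_inf (- q) q * (qpoch_inf (q ^ 5) (q ^ 6) * qpoch_inf (q ^ 1) (q ^ 6)
       * qpoch_inf (q ^ 6) (q ^ 6)) / qpoch_inf q q).
Proof.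
  intros H.
  refine (bailey_series _ _ _ _ _ _ _ (fun N => qpoch (- q) q N) _ _ H H _
    (bailey_pair_rr_beta1 q H) (rr_beta_bounded q 1 H) _ _
    (jacobi_triple_product_odd (q ^ 5) (q ^ 1) (q ^ 6) _ _ _ _)).
  - simpl. ring.
  - intros N r Hr. rewrite (qpoch_cut (- q) q r N Hr). qpow r.
  - now apply qpoch_inf_correct.
  - now apply (Cmod_pow_lt1 q 4).
  - now apply (Cmod_pow_lt1 q 0).
  - now apply (Cmod_pow_lt1 q 5).
  - rewrite <- Cpow_add_r. reflexivity.
Qed.

Lemma rr_series_mod12_5_7 (q : C) : (Cmod q < 1)%R ->
  Clim (Csum_to (fun n => qpoch (- q) (q ^ 2) n * q ^ n * (q ^ 2) ^ tri n * rr_beta (q ^ 2) 0 n))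
    (qpoch_inf (- q) (q ^ 2) * (qpoch_inf (q ^ 7) (q ^ 12) * qpoch_inf (q ^ 5) (q ^ 12)
       * qpoch_inf (q ^ 12) (q ^ 12)) / qpoch_inf (q ^ 2) (q ^ 2)).
Proof.
  intros H. assert (H2 : (Cmod (q ^ 2) < 1)%R) by now apply (Cmod_pow_lt1 q 1).
  refine (bailey_series _ _ _ _ _ _ _ (fun N => qpoch (- q) (q ^ 2) N) _ _ H2 H _
    (bailey_pair_rr_beta0 _ H2) (rr_beta_bounded _ 0 H2) _ _
    (jacobi_triple_product_even (q ^ 7) (q ^ 5) (q ^ 12) _ _ _ _)).
  - simpl. ring.
  - intros N [|s] Hr; rewrite (qpoch_cut (- q) (q ^ 2) _ N Hr).
    + simpl. ring.
    + qpow s.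
  - now apply qpoch_inf_correct.
  - now apply (Cmod_pow_lt1 q 6).
  - now apply (Cmod_pow_lt1 q 4).
  - now apply (Cmod_pow_lt1 q 11).
  - rewrite <- Cpow_add_r. reflexivity.
Qed.

Lemma rr_series_mod12_3_9 (q : C) : (Cmod q < 1)%R ->
  Clim (Csum_to (fun n => qpoch (- q) (q ^ 2) n * q ^ n * (q ^ 2) ^ tri n * rr_beta (q ^ 2) 1 n))
    (qpoch_inf (- q) (q ^ 2) * (qpoch_inf (q ^ 9) (q ^ 12) * qpoch_inf (q ^ 3) (q ^ 12)
       * qpoch_inf (q ^ 12) (q ^ 12)) / qpoch_inf (q ^ 2) (q ^ 2)).
Proof.
  intros H. assert (H2 : (Cmod (q ^ 2) < 1)%R) by now apply (Cmod_pow_lt1 q 1).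
  refine (bailey_series _ _ _ _ _ _ _ (fun N => qpoch (- q) (q ^ 2) N) _ _ H2 H _
    (bailey_pair_rr_beta1_lower _ H2) (rr_beta_bounded _ 1 H2) _ _
    (jacobi_triple_product_even (q ^ 9) (q ^ 3) (q ^ 12) _ _ _ _)).
  - simpl. ring.
  - intros N [|s] Hr; rewrite (qpoch_cut (- q) (q ^ 2) _ N Hr).
    + simpl. ring.
    + qpow s.
  - now apply qpoch_inf_correct.
  - now apply (Cmod_pow_lt1 q 8).
  - now apply (Cmod_pow_lt1 q 2).
  - now apply (Cmod_pow_lt1 q 11).
  - rewrite <- Cpow_add_r. reflexivity.
Qed.

Lemma rr_series_mod12_1_11 (q : C) : (Cmod q < 1)%R ->
  Clim (Csum_to (fun n => qpoch (- q) (q ^ 2) n * (q ^ 3) ^ n * (q ^ 2) ^ tri n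
      * rr_beta (q ^ 2) 1 n))
    (qpoch_inf (- q) (q ^ 2) * (qpoch_inf (q ^ 11) (q ^ 12) * qpoch_inf (q ^ 1) (q ^ 12)
       * qpoch_inf (q ^ 12) (q ^ 12)) / qpoch_inf (q ^ 2) (q ^ 2)).
Proof.
  intros H. assert (H2 : (Cmod (q ^ 2) < 1)%R) by now apply (Cmod_pow_lt1 q 1).
  assert (H3 : (Cmod (q ^ 3) < 1)%R) by now apply (Cmod_pow_lt1 q 2).
  refine (bailey_series _ _ _ _ _ _ _ (fun N => qpoch (- q) (q ^ 2) (S N)) _ _ H2 H3 _
    (bailey_pair_rr_beta1 _ H2) (rr_beta_bounded _ 1 H2) _ _
    (jacobi_triple_product_odd (q ^ 11) (q ^ 1) (q ^ 12) _ _ _ _)).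
  - simpl. ring.
  (* Since sigma = rho p, the two products together miss the factor 1 + q^(2r+1) of (-q;q^2)_(N+1).
     It is supplied by 1 - p^(2r+1) = (1 - q^(2r+1)) (1 + q^(2r+1)), hence [S N] in place of [N]. *)
  - intros N r Hr. rewrite (qpoch_cut (- q) (q ^ 2) (S r) (S N)), qpoch_S by lia.
    simpl (S N - S r)%nat.
    replace (- q * (q ^ 2) ^ S r) with (- q ^ 3 * (q ^ 2) ^ r)
      by (rewrite (Cpow_S (q ^ 2)); simpl; ring).
    qpow r.
  - apply (Clim_subseq (qpoch (- q) (q ^ 2)) _ S 0); [lia|]. now apply qpoch_inf_correct.
  - now apply (Cmod_pow_lt1 q 10).
  - now apply (Cmod_pow_lt1 q 0).
  - now apply (Cmod_pow_lt1 q 11).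
  - rewrite <- Cpow_add_r. reflexivity.
Qed.

Lemma is_series_rr_beta (p : C) e (w w' f : nat -> C) (l l' : C) :
  (Cmod p < 1)%R -> (forall i, f i = p ^ (i * i + e * i)) ->
  (forall n, w n = w' n) -> l = l' ->
  Clim (Csum_to (fun n => w' n * rr_beta p e n)) l ->
  is_series (K := C_AbsRing) (V := C_NormedModule)
    (fun n => w n / qpoch p p n * Csum_to (fun i => f i * qbinom p n i) n) l'.
Proof.
  intros H Hf Hw <- HL. apply is_series_Clim. revert HL. apply Clim_ext. intros N.
  apply Csum_ext; intros n _. rewrite (rr_beta_qbinom p e n f H Hf), Hw.
  field. auto with qs.
Qed.

Lemma qpoch_inf_q3 (q : C) : (Cmod q < 1)%R ->
  qpoch_inf (q ^ 3) (q ^ 3) = qpoch_inf (q ^ 3) (q ^ 6) * qpoch_inf (q ^ 6) (q ^ 6).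
Proof.
  intros H. rewrite (qpoch_inf_split2 (q ^ 3) (q ^ 3)) by now apply (Cmod_pow_lt1 q 2).
  now rewrite <- Cpow_mult_r, <- Cpow_add_r.
Qed.

(** Euler's identity (-q;q)_oo (q;q^2)_oo = 1, with the odd exponents sorted modulo 6. It follows
    from (q;q)_oo = (q;q^2)_oo (q^2;q^2)_oo and (q^2;q^2)_oo = (q;q)_oo (-q;q)_oo by cancelling
    (q;q)_oo. *)
Lemma qpoch_inf_mod6 (q : C) : (Cmod q < 1)%R ->
  qpoch_inf (- q) q * (qpoch_inf (q ^ 1) (q ^ 6) * qpoch_inf (q ^ 3) (q ^ 6)
    * qpoch_inf (q ^ 5) (q ^ 6)) = 1.
Proof.
  intros H. assert (H2 : (Cmod (q ^ 2) < 1)%R) by now apply (Cmod_pow_lt1 q 1).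
  pose proof (qpoch_inf_neq0 q H) as Hn.
  assert (E : qpoch_inf q q = (qpoch_inf (q ^ 1) (q ^ 6) * qpoch_inf (q ^ 3) (q ^ 6)
    * qpoch_inf (q ^ 5) (q ^ 6)) * (qpoch_inf q q * qpoch_inf (- q) q)).
  { rewrite (qpoch_inf_opp q q H), (qpoch_inf_split2 q q H) at 1.
    replace (q * q) with (q ^ 2) by (simpl; ring). f_equal.
    rewrite (qpoch_inf_split3 q (q ^ 2) H2), <- !Cpow_mult_r.
    rewrite <- !Cpow_S, Cpow_1_r. reflexivity. }
  replace (RtoC 1) with (qpoch_inf q q * / qpoch_inf q q) by (field; easy).
  rewrite E at 1. field. easy.
Qed.

Theorem theorem3p3 (q : C) (hq : (Cmod q < 1)%R) :
  is_series (K := C_AbsRing) (V := C_NormedModule)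
    (fun n => Cpow q ((n * (n + 1)) / 2) * qpoch (-1) q n / qpoch q q n
              * Csum_to (fun i => Cpow q (i * i) * qbinom q n i) n)
    (qpoch_inf (Cpow q 2) (Cpow q 2) * Cpow (qpoch_inf (Cpow q 3) (Cpow q 3)) 2
     / (Cpow (qpoch_inf q q) 2 * qpoch_inf (Cpow q 6) (Cpow q 6)))
  /\
  is_series (K := C_AbsRing) (V := C_NormedModule)
    (fun n => Cpow q ((n * (n + 1)) / 2) * qpoch (- q) q n / qpoch q q n
              * Csum_to (fun i => Cpow q (i * i + i) * qbinom q n i) n)
    (Cpow (qpoch_inf (Cpow q 6) (Cpow q 6)) 2
     / (qpoch_inf q q * qpoch_inf (Cpow q 3) (Cpow q 3)))
  /\
  is_series (K := C_AbsRing) (V := C_NormedModule)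
    (fun n => Cpow q (n * n) * qpoch (- q) (Cpow q 2) n / qpoch (Cpow q 2) (Cpow q 2) n
              * Csum_to (fun i => Cpow q (2 * i * i) * qbinom (Cpow q 2) n i) n)
    (qpoch_inf (- q) (Cpow q 2)
     * (qpoch_inf (Cpow q 5) (Cpow q 12) * qpoch_inf (Cpow q 7) (Cpow q 12) * qpoch_inf (Cpow q 12) (Cpow q 12))
     / qpoch_inf (Cpow q 2) (Cpow q 2))
  /\
  is_series (K := C_AbsRing) (V := C_NormedModule)
    (fun n => Cpow q (n * n) * qpoch (- q) (Cpow q 2) n / qpoch (Cpow q 2) (Cpow q 2) n
              * Csum_to (fun i => Cpow q (2 * i * i + 2 * i) * qbinom (Cpow q 2) n i) n)
    (qpoch_inf (- q) (Cpow q 2)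
     * (qpoch_inf (Cpow q 3) (Cpow q 12) * qpoch_inf (Cpow q 9) (Cpow q 12) * qpoch_inf (Cpow q 12) (Cpow q 12))
     / qpoch_inf (Cpow q 2) (Cpow q 2))
  /\
  is_series (K := C_AbsRing) (V := C_NormedModule)
    (fun n => Cpow q (n * n + 2 * n) * qpoch (- q) (Cpow q 2) n / qpoch (Cpow q 2) (Cpow q 2) n
              * Csum_to (fun i => Cpow q (2 * i * i + 2 * i) * qbinom (Cpow q 2) n i) n)
    (qpoch_inf (- q) (Cpow q 2)
     * (qpoch_inf q (Cpow q 12) * qpoch_inf (Cpow q 11) (Cpow q 12) * qpoch_inf (Cpow q 12) (Cpow q 12))
     / qpoch_inf (Cpow q 2) (Cpow q 2)).
Proof.
  assert (H2 : (Cmod (q ^ 2) < 1)%R) by now apply (Cmod_pow_lt1 q 1).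
  assert (H3 : (Cmod (q ^ 3) < 1)%R) by now apply (Cmod_pow_lt1 q 2).
  assert (H6 : (Cmod (q ^ 6) < 1)%R) by now apply (Cmod_pow_lt1 q 5).
  pose proof (qpoch_inf_neq0 q hq) as N1.
  pose proof (qpoch_inf_neq0 (q ^ 2) H2) as N2.
  pose proof (qpoch_inf_neq0 (q ^ 3) H3) as N3.
  pose proof (qpoch_inf_neq0 (q ^ 6) H6) as N6.
  assert (N36 : qpoch_inf (q ^ 3) (q ^ 6) <> 0).
  { intros E. apply N3. rewrite qpoch_inf_q3, E by easy. ring. }
  split; [|split; [|split; [|split]]].
  - refine (is_series_rr_beta q 0 _ _ _ _ _ hq _ _ _ (rr_series_mod6_3_3 q hq)).
    + intros i. f_equal. lia.
    + intros n. rewrite tri_div, Cpow_add_r.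
      replace (RtoC (-1)) with (- (1)) by (rewrite <- RtoC_opp; f_equal; lra). ring.
    + rewrite qpoch_inf_q3, <- (qpoch_inf_opp q q) by easy.
      rewrite (Cpow_S (_ * _) 1), (Cpow_S (qpoch_inf q q) 1), !Cpow_1_r. field. auto.
  - refine (is_series_rr_beta q 1 _ _ _ _ _ hq _ _ _ (rr_series_mod6_1_5 q hq)).
    + intros i. f_equal. lia.
    + intros n. rewrite tri_div, Cpow_add_r. ring.
    + rewrite qpoch_inf_q3 by easy.
      pose proof (qpoch_inf_mod6 q hq) as E.
      (* Numerator and denominator are multiplied by (q^3;q^6)_oo, so that Euler's identity removes
         all odd residues at once. *)
      replace (qpoch_inf (- q) q * (qpoch_inf (q ^ 5) (q ^ 6) * qpoch_inf (q ^ 1) (q ^ 6)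
        * qpoch_inf (q ^ 6) (q ^ 6)) / qpoch_inf q q)
        with (qpoch_inf (- q) q * (qpoch_inf (q ^ 1) (q ^ 6) * qpoch_inf (q ^ 3) (q ^ 6)
          * qpoch_inf (q ^ 5) (q ^ 6)) * qpoch_inf (q ^ 6) (q ^ 6)
          / (qpoch_inf q q * qpoch_inf (q ^ 3) (q ^ 6))) by (field; auto).
      rewrite E. rewrite (Cpow_S _ 1), Cpow_1_r. field. auto.
  - refine (is_series_rr_beta (q ^ 2) 0 _ _ _ _ _ H2 _ _ _ (rr_series_mod12_5_7 q hq)).
    + intros i. rewrite <- Cpow_mult_r. f_equal. lia.
    + intros n. rewrite <- (tri_double n), Nat.add_comm, Cpow_add_r, Cpow_mult_r. ring.
    + f_equal. ring.
  - refine (is_series_rr_beta (q ^ 2) 1 _ _ _ _ _ H2 _ _ _ (rr_series_mod12_3_9 q hq)).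
    + intros i. rewrite <- Cpow_mult_r. f_equal. lia.
    + intros n. rewrite <- (tri_double n), Nat.add_comm, Cpow_add_r, Cpow_mult_r. ring.
    + f_equal. ring.
  - refine (is_series_rr_beta (q ^ 2) 1 _ _ _ _ _ H2 _ _ _ (rr_series_mod12_1_11 q hq)).
    + intros i. rewrite <- Cpow_mult_r. f_equal. lia.
    + intros n. rewrite <- (tri_double n).
      replace (2 * tri n + n + 2 * n)%nat with (2 * tri n + 3 * n)%nat by lia.
      rewrite Cpow_add_r, !Cpow_mult_r. ring.
    + rewrite Cpow_1_r. f_equal. ring.
Qed.
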